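(* $F_e(3,3;4) \leq 786$. That is, there exists a $K_4$-free simple graph on $786$ vertices such that every $2$-coloring of its edges contains a monochromatic triangle.
   Context: For a simple graph $G$, $G \rightarrow (3,3)$ means that every coloring of the edges of $G$ with two colors yields a triangle ($K_3$) all of whose edges have the same color. The edge Folkman number $F_e(3,3;4)$ is the smallest number of vertices of a graph $G$ that contains no $K_4$ (complete graph on 4 vertices) and satisfies $G \rightarrow (3,3)$. *)

(* Defs.v *)
From HB Require Import structures.
From mathcomp Require Import all_boot.

Set Implicit Arguments.
Unset Strict Implicit.
Unset Printing Implicit Defensive.

Record sgraph := SGraph {
  vertex :> finType;
  adj : rel vertex;
  adj_sym : symmetric adj;
  adj_irrefl : irreflexive adj
}.

Definition edges (G : sgraph) : {set {set G}} :=
  [set [set p.1; p.2] | p : G * G & adj p.1 p.2].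

Definition clique (G : sgraph) (A : {set G}) : Prop :=
  {in A &, forall x y, x != y -> adj x y}.

Definition Kfree (k : nat) (G : sgraph) : Prop :=
  ~ exists2 A : {set G}, #|A| = k & clique A.

(* A 2-coloring is a total function on vertex sets, of which only the values
   on [edges G] matter. *)
Definition monochromatic (G : sgraph) (c : {set G} -> bool) (A : {set G}) :
    Prop :=
  exists b : bool, forall E, E \in edges G -> E \subset A -> c E = b.

(* G -> (3,3) *)
Definition arrows33 (G : sgraph) : Prop :=
  forall c : {set G} -> bool,
    exists A : {set G}, [/\ #|A| = 3, clique A & monochromatic c A].

(* "n = F_e(3,3;4)", as a relation because the existence of a K_4-free graph
   with G -> (3,3) is itself a theorem. *)
Definition is_Fe334 (n : nat) : Prop :=
  (exists G : sgraph, [/\ #|G| = n, Kfree 4 G & arrows33 G]) /\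
  (forall G : sgraph, Kfree 4 G -> arrows33 G -> n <= #|G|).

(* Main.v *)
Require Import Defs.
From HB Require Import structures.
From Stdlib Require Import ZArith FMapPositive Reals Lra Classical.
From mathcomp Require Import all_boot all_order all_algebra.

(* Let S be the subgroup of order 156 generated by 53 in the units modulo 785,
   and let L be the Cayley graph of Z/785 with connection set S; no element of
   S is divisible by 5, so reduction modulo 5 maps L to K5. Regard a
   2-coloring of the edges of L as a vector x with entries +1 and -1, and let H
   be the graph on the edges of L in which two edges are adjacent when they lie
   in a common triangle. Every edge lies in 21 triangles, and x has no
   monochromatic triangle exactly when x^T (A_H + 14) x = 0. The space of
   pullbacks from the edges of K5 is invariant under A_H, which acts on it as 7
   times the line graph of K5, so A_H + 14 is nonnegative there. On the
   orthogonal complement A_H + 14 is positive definite: the discrete Fourier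
   transform over Z/785 splits it into 78 x 78 real symmetric blocks indexed by
   the characters, the action of S leaves seven of them to consider, and these
   are bounded below by a Cholesky decomposition in integer arithmetic. Hence
   the colorings of L without monochromatic triangle are the pullbacks of the 12
   partitions of K5 into two pentagons. One more vertex, joined to 13 vertices
   of L that span no triangle, keeps the graph K4-free, and none of these 12
   colorings extends to it. *)

Set Implicit Arguments.
Unset Strict Implicit.
Unset Printing Implicit Defensive.

(** * Numerical bounds on the angle 2 pi / 785 *)

Section RealBounds.
Local Open Scope R_scope.

Lemma PI_bounds : 3.141592653 <= PI <= 3.141592654.
Proof.
(* Ten terms of the alternating series for pi/4 = 2 atan(1/3) + atan(1/7) settle nine decimals. *)
pose proof (PI_2_3_7_ineq 4) as H.
unfold tg_alt, PI_2_3_7_tg, Ratan_seq in H; simpl in H; lra.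
Qed.

Lemma sin_cos_bounds (x : R) : 0 <= x <= 1 ->
  x - x ^ 3 / 6 <= sin x <= x - x ^ 3 / 6 + x ^ 5 / 120 /\
  1 - x ^ 2 / 2 <= cos x <= 1 - x ^ 2 / 2 + x ^ 4 / 24.
Proof.
intros Hx; pose proof PI_bounds as HP.
assert (Hs : x - x ^ 3 / 6 <= sin x <= x - x ^ 3 / 6 + x ^ 5 / 120).
  pose proof (pre_sin_bound x 0 ltac:(lra) ltac:(lra)) as H.
  unfold sin_approx, sin_term in H; simpl in H.
  simpl; lra.
assert (Hc : 1 - x ^ 2 / 2 <= cos x <= 1 - x ^ 2 / 2 + x ^ 4 / 24).
  pose proof (pre_cos_bound x 0 ltac:(lra) ltac:(lra)) as H.
  unfold cos_approx, cos_term in H; simpl in H.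
  simpl; lra.
now split.
Qed.

(** The two integers are the later [cos1] and [sin1], and 2 is the tolerance that [rotation_step]
    asks for. *)
Lemma sin_cos_angle :
  Rabs (2 ^ 32 * cos (2 * PI / 785) - 4294829718) <= 2 /\
  Rabs (2 ^ 32 * sin (2 * PI / 785) - 34376799) <= 2.
Proof.
pose proof PI_bounds as HP.
set (x := 2 * PI / 785).
assert (Hx : 6.283185306 / 785 <= x <= 6.283185308 / 785) by (unfold x; lra).
destruct (@sin_cos_bounds x ltac:(lra)) as [Hs Hc].
assert (Hpow : forall n, (6.283185306 / 785) ^ n <= x ^ n
                         <= (6.283185308 / 785) ^ n).
  intro n; split; apply pow_incr; lra.
pose proof (Hpow 2%N) as H2; pose proof (Hpow 3%N) as H3.
pose proof (Hpow 4%N) as H4; pose proof (Hpow 5%N) as H5.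
clear Hpow; clearbody x.
(* With each bounded power of x as an atom, both goals are linear. *)
set (x2 := x ^ 2) in *; set (x3 := x ^ 3) in *.
set (x4 := x ^ 4) in *; set (x5 := x ^ 5) in *.
split; apply Rabs_le; lra.
Qed.

Lemma cos_sin_period_nat (n : nat) (x : R) :
  cos (x + INR n * (2 * PI)) = cos x /\ sin (x + INR n * (2 * PI)) = sin x.
Proof.
replace (x + INR n * (2 * PI)) with (x + 2 * INR n * PI) by ring.
now rewrite cos_period sin_period.
Qed.

Lemma cos_lt1 (x : R) : 0 < x < 2 * PI -> cos x <> 1.
Proof.
intros Hx Hc.
assert (Hs : 0 < sin (x / 2)) by (apply sin_gt_0; lra).
replace x with (2 * (x / 2)) in Hc by field.
rewrite cos_2a_sin in Hc.
pose proof (Rmult_lt_0_compat _ _ Hs Hs); lra.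
Qed.

Lemma angle_mul785 : 785 * (2 * PI / 785) = 2 * PI.
Proof. field. Qed.

Lemma angle_gt0 : 0 < 2 * PI / 785.
Proof. pose proof PI_RGT_0; lra. Qed.

End RealBounds.

From mathcomp Require Import Rstruct ssrZ zify ring lra.

Import Order.TTheory GRing.Theory Num.Theory.
Local Open Scope ring_scope.
Delimit Scope Z_scope with bZ.

(** * Integer certificates of positive semidefiniteness *)

(** All computation takes place on binary integers; [zr] reads their results as real numbers and as
    residues modulo 785 and 5. *)
Definition zr (A : pzRingType) (z : Z) : A := (int_of_Z z)%:~R.
Arguments zr {A} z.

Section ZrRing.
Variable A : pzRingType.

Lemma zr0 : zr 0 = 0 :> A.
Proof. by []. Qed.

Lemma zrD (x y : Z) : zr (x + y)%bZ = zr x + zr y :> A.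
Proof. by rewrite /zr -[(x + y)%bZ]/(x + y) !rmorphD. Qed.

Lemma zrM (x y : Z) : zr (x * y)%bZ = zr x * zr y :> A.
Proof. by rewrite /zr -[(x * y)%bZ]/(x * y) !rmorphM. Qed.

Lemma zrN (x : Z) : zr (- x)%bZ = - zr x :> A.
Proof. by rewrite /zr -[(- x)%bZ]/(- x) !rmorphN. Qed.

Lemma zrB (x y : Z) : zr (x - y)%bZ = zr x - zr y :> A.
Proof. by rewrite zrD zrN. Qed.

Lemma zrX (x : Z) (n : nat) : zr (x ^ Z.of_nat n)%bZ = zr x ^+ n :> A.
Proof.
elim: n => [|n IH]; first by rewrite expr0.
by rewrite Nat2Z.inj_succ Z.pow_succ_r ?zrM ?IH ?exprS //; lia.
Qed.

Lemma zr_nat (n : nat) : zr (Z.of_nat n) = n%:R :> A.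
Proof. by rewrite /zr -[Z.of_nat n]/(Z_of_int n) Z_of_intK. Qed.

End ZrRing.

Definition chol_entry (q x : Z) : Z := ((x + q / 2) / q)%bZ.

Fixpoint sub_scaled (v : seq Z) (a : Z) (l : seq Z) : seq Z :=
  match v, l with
  | x :: v', b :: l' => (x - a * b)%bZ :: sub_scaled v' a l'
  | _, _ => v
  end.

(** A symmetric matrix is stored as the rows of its upper triangle. Besides l l^T, the update takes
    the absolute residuals of the pivot row off the diagonal, so that rounding is accounted for in
    exact arithmetic. *)
Fixpoint schur (M : seq (seq Z)) (l r : seq Z) : seq (seq Z) :=
  match M, l, r with
  | (p :: v) :: M', a :: l', b :: r' =>
      ((p - a * a - b)%bZ :: sub_scaled v a l') :: schur M' l' r'
  | _, _, _ => M
  end.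

Definition residual (q : Z) (v l : seq Z) : seq Z :=
  [seq Z.abs (p.1 - q * p.2)%bZ | p <- zip v l].

(* Lowering the pivot root by 20 makes room for the residuals: each of the at
   most 77 is at most [q / 2], so their sum is below [2 * 20 * q]. *)
Fixpoint chol_check (n : nat) (M : seq (seq Z)) : bool :=
  match n, M with
  | n'.+1, (p :: v) :: M' =>
      let q := (Z.sqrt p - 20)%bZ in
      let l := map (chol_entry q) v in
      let r := residual q v l in
      (q * q + foldr Z.add 0%bZ r <=? p)%bZ && chol_check n' (schur M' l r)
  | _, _ => nilp M
  end.

Fixpoint tri_mx (B : Z -> Z -> Z) (s : seq Z) : seq (seq Z) :=
  if s is i :: s' then map (B i) s :: tri_mx B s' else [::].

Fixpoint triangular (M : seq (seq Z)) : bool :=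
  if M is row :: M' then (size row == size M) && triangular M' else true.

Lemma triangular_tri_mx B s : triangular (tri_mx B s).
Proof.
have sz t : size (tri_mx B t) = size t by elim: t => //= i t ->.
by elim: s => //= i s ->; rewrite size_map sz eqxx.
Qed.

Section Cholesky.
Variable R : realFieldType.

Lemma zr_ge0 (x : Z) : (0 <= x)%bZ -> 0 <= zr x :> R.
Proof. by move=> x0; rewrite /zr ler0z; case: x x0 => //= p; lia. Qed.

Lemma zr_le (x y : Z) : (x <= y)%bZ -> zr x <= zr y :> R.
Proof. by move=> xy; rewrite -subr_ge0 -zrB; apply: zr_ge0; lia. Qed.

Fixpoint dot (v : seq Z) (z : seq R) : R :=
  match v, z with
  | a :: v', x :: z' => zr a * x + dot v' z'
  | _, _ => 0
  end.

Fixpoint tri_form (M : seq (seq Z)) (z : seq R) : R :=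
  match M, z with
  | (p :: v) :: M', x :: z' =>
      zr p * x ^+ 2 + 2 * x * dot v z' + tri_form M' z'
  | _, _ => 0
  end.

Lemma dot_sub_scaled v a l z : size l = size v ->
  dot (sub_scaled v a l) z = dot v z - zr a * dot l z.
Proof.
elim: v l z => [|x v IH] [|b l] //= z; first by rewrite mulr0 subr0.
case: z => [|y z] [] szl /=; first by ring.
by rewrite (IH l z szl) zrB zrM; ring.
Qed.

Lemma size_sub_scaled v a l : size (sub_scaled v a l) = size v.
Proof. by elim: v l => [|x v IH] [|b l] //=; rewrite IH. Qed.

Lemma size_schur M l r : size (schur M l r) = size M.
Proof. by elim: M l r => [|[|p v] M IH] [|b l] [|a r] //=; rewrite IH. Qed.

Lemma triangular_schur M l r : triangular M -> triangular (schur M l r).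
Proof.
elim: M l r => [|[|p v] M IH] [|b l] [|a r] //= /andP[szv tM].
by rewrite size_sub_scaled size_schur szv IH.
Qed.

Lemma tri_form_schur M l r z : triangular M ->
  size l = size M -> size r = size M -> size z = size M ->
  tri_form (schur M l r) z
    = tri_form M z - dot l z ^+ 2 - dot r (map (fun x => x ^+ 2) z).
Proof.
elim: M l r z => [|[|p v] M IH] [|a l] [|b r] [|x z] //=.
  by move=> _ _ _ _; rewrite expr0n subrr subr0.
case/andP=> /eqP [szv] tM [szl] [szr] [szz].
by rewrite IH // dot_sub_scaled ?szl ?szv // !zrB zrM; ring.
Qed.

(** Entry by entry, 2 x y w >= - |w| (x^2 + y^2), because (x + y)^2 and (x - y)^2 are
    nonnegative. *)
Lemma cross_term_bound (q : Z) v l (x : R) z :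
  size l = size v -> size z = size v ->
  - (zr (foldr Z.add 0%bZ (residual q v l)) * x ^+ 2
     + dot (residual q v l) (map (fun x => x ^+ 2) z))
    <= 2 * x * (dot v z - zr q * dot l z).
Proof.
rewrite /residual.
elim: v l z => [|a v IH] [|b l] [|y z] //=.
  by move=> _ _; rewrite /zr /=; lra.
case=> szl [szz]; have := IH _ _ szl szz; rewrite zrD.
set t := zr (foldr _ _ _); set d := dot (map _ _) _.
set w := (a - q * b)%bZ.
suff : - (zr (Z.abs w) * (x ^+ 2 + y ^+ 2)) <= 2 * x * y * zr w.
  by rewrite zrB zrM; nra.
have x_y : 0 <= (x + y) ^+ 2 by exact: sqr_ge0.
have x_Ny : 0 <= (x - y) ^+ 2 by exact: sqr_ge0.
have [w0|w0] : ((0 <= w)%bZ \/ (0 <= - w)%bZ)%type by lia.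
  by rewrite Z.abs_eq //; have := zr_ge0 w0; nra.
by rewrite Z.abs_neq; [have := zr_ge0 w0; rewrite zrN; nra | lia].
Qed.

(* Completing the square with the integers [q], [l] leaves the cross terms
   [2 x r_j z_j], which are paid for by [|r_j|] on the two diagonal entries. *)
Lemma chol_checkP n M z : triangular M -> chol_check n M ->
  size z = size M -> 0 <= tri_form M z.
Proof.
elim: n M z => [|n IH] [|[|p v] M] // [|x z] //=.
case/andP=> /eqP[szv] tM /andP[].
set q := (Z.sqrt p - 20)%bZ; set l := map _ v; set r := residual q v l.
move/Z.leb_le=> /zr_le; rewrite zrD zrM => piv chk [szz].
have szl : size l = size v by rewrite size_map.
have szr : size r = size v by rewrite size_map size_zip szl minnn.
have := IH _ z (triangular_schur l r tM) chk.
rewrite size_schur => /(_ szz); rewrite tri_form_schur ?szl ?szr //.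
have := @cross_term_bound q v l x z szl; rewrite szz => /(_ (esym szv)).
rewrite -/r; set D := dot r _; set E := tri_form M z.
have : 0 <= (zr q * x + dot l z) ^+ 2 by exact: sqr_ge0.
have : 0 <= x ^+ 2 by exact: sqr_ge0.
by nra.
Qed.

Lemma tri_form_tri_mx B s (z : Z -> R) : (forall i j, B i j = B j i) ->
  tri_form (tri_mx B s) (map z s)
    = \sum_(i <- s) \sum_(j <- s) zr (B i j) * z i * z j.
Proof.
move=> Bsym; have dotE i t :
    dot (map (B i) t) (map z t) = \sum_(j <- t) zr (B i j) * z j.
  by elim: t => [|j t IH] /=; rewrite (big_nil, big_cons) ?IH.
elim: s => [|i s IH] /=; first by rewrite big_nil.
rewrite IH !big_cons dotE.
under [X in _ = _ + X]eq_bigr => j _ do rewrite big_cons.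
rewrite big_split /=.
have -> : \sum_(j <- s) zr (B j i) * z j * z i
    = z i * \sum_(j <- s) zr (B i j) * z j.
  by rewrite mulr_sumr; apply: eq_bigr => j _; rewrite Bsym; ring.
have -> : \sum_(j <- s) zr (B i j) * z i * z j
    = z i * \sum_(j <- s) zr (B i j) * z j.
  by rewrite mulr_sumr; apply: eq_bigr => j _; ring.
by ring.
Qed.

Lemma chol_psd B s (z : Z -> R) : (forall i j, B i j = B j i) ->
  chol_check (size s) (tri_mx B s) ->
  0 <= \sum_(i <- s) \sum_(j <- s) zr (B i j) * z i * z j.
Proof.
move=> Bsym chk; rewrite -tri_form_tri_mx //.
apply: chol_checkP chk _; first exact: triangular_tri_mx.
by rewrite size_map; elim: (s) => //= i t ->.
Qed.

End Cholesky.

(** * The connection set and the integer matrices *)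

(** A binary trie makes lookups cheap in the large checks. Keys are positive, so entry i is stored
    under i + 1. *)
Definition tabulate (A : Type) (s : seq A) : PositiveMap.t A :=
  (foldl (fun m x => (PositiveMap.add m.2 x m.1, Pos.succ m.2))
     (PositiveMap.empty A, xH) s).1.

Definition lookup (A : Type) (d : A) (m : PositiveMap.t A) (x : Z) : A :=
  odflt d (PositiveMap.find (Z.to_pos (x + 1)) m).

Definition zp (x : Z) : Z := (x mod 785)%bZ.

Definition zrange (n : nat) : seq Z := map Z.of_nat (iota 0 n).

Definition mul53 (x : Z) : Z := zp (53 * x)%bZ.

Definition conn_seq : seq Z := traject mul53 1%bZ 156.

Definition conn_table : PositiveMap.t bool :=
  Eval vm_compute in tabulate [seq has (Z.eqb x) conn_seq | x <- zrange 785].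

Definition connz (x : Z) : bool := lookup false conn_table (zp x).

(* [cos (2 * pi / 785)] and [sin (2 * pi / 785)] in units of [2^-32]. *)
Definition cos1 : Z := 4294829718%bZ.
Definition sin1 : Z := 34376799%bZ.

(** Fixed-point multiplication by exp(2 pi i / 785), both coordinates rounded down. *)
Definition rotate (w : Z * Z) : Z * Z :=
  (((w.1 * cos1 - w.2 * sin1) / 2 ^ 32)%bZ,
   ((w.1 * sin1 + w.2 * cos1) / 2 ^ 32)%bZ).

(** The last ten bits are guard bits: they absorb the error that accumulates along the
    recurrence. *)
Definition cos_seq : seq Z :=
  [seq (w.1 / 2 ^ 10)%bZ | w <- traject rotate (2 ^ 32, 0)%bZ 785].

Definition cos_table : PositiveMap.t Z := Eval vm_compute in tabulate cos_seq.

Definition cosz (x : Z) : Z := lookup 0%bZ cos_table (zp x).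

Definition conn_list : seq Z :=
  Eval vm_compute in [seq x <- zrange 785 | connz x].

(* One element of each pair [{a, - a}] of the connection set. *)
Definition reps : seq Z :=
  Eval vm_compute in [seq x <- zrange 393 | connz x].

(** Squares modulo 5 agree exactly when i = j or i = - j modulo 5, so the units fall into the sides
    {1, 4} and {2, 3}. *)
Definition same_side (i j : Z) : bool :=
  let sq x := (x * x mod 5)%bZ in (sq i =? sq j)%bZ.

(* The block of the mode [k] in units of [2^-22], with [14] on the diagonal
   lowered to [13.8]. The penalty is the form (sum of z over a = 1, 4 mod 5)^2
   + (sum of z over a = 2, 3 mod 5)^2, which lifts the kernel that the block
   has when [5 k = 0]. *)
Definition spectral_entry (pen : bool) (k i j : Z) : Z :=
  let e t := if connz t then (2 * cosz (k * t))%bZ else 0%bZ in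
  (e (Z.abs (i - j)) + e (i + j)
   + (if i =? j then 13 * 2 ^ 22 + 2 ^ 22 * 8 / 10 else 0)
   + (if pen && same_side i j then 2 ^ 22 else 0))%bZ.

Definition spectral_check (pen : bool) (k : Z) : bool :=
  chol_check 78 (tri_mx (spectral_entry pen k) reps).

(** * Fourier analysis of the edge form *)

(** These algebraic properties of cos and sin at multiples of 2 pi / (n + 2) suffice for a Fourier
    analysis over a real field, with no complex numbers. *)
Record trig_system (R : realFieldType) (n : nat) (c s : 'I_n.+2 -> R) : Prop :=
  TrigSystem {
    trig_c0 : c 0 = 1;
    trig_cN : forall x, c (- x) = c x;
    trig_sN : forall x, s (- x) = - s x;
    trig_cD : forall x y, c (x + y) = c x * c y - s x * s y;
    trig_sD : forall x y, s (x + y) = s x * c y + c x * s y;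
    trig_c_neq1 : forall x, x != 0 -> c x != 1
  }.

Section Fourier.
Variables (R : realFieldType) (n : nat) (c s : 'I_n.+2 -> R).
Hypothesis trig : trig_system c s.
Hypothesis double_inj : forall x : 'I_n.+2, x + x = 0 -> x = 0.
Variable S : pred 'I_n.+2.
Hypothesis S_opp : forall x, S (- x) = S x.

(** Shifting k by 1 shows that the vector of the cosine and sine sums is fixed by the rotation
    through the angle of x. For x nonzero this rotation is not the identity, so the vector is 0. *)
Lemma sum_trig (x : 'I_n.+2) : \sum_k c (k * x) = n.+2%:R * (x == 0)%:R.
Proof.
have [->|x0] := eqVneq x 0.
  under eq_bigr => k _ do rewrite mulr0 (trig_c0 trig).
  by rewrite sumr_const card_ord mulr1.
rewrite mulr0; set Sc := \sum_k _; pose Ss := \sum_k s (k * x).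
have Ec : Sc = Sc * c x - Ss * s x.
  rewrite {1}/Sc (reindex_inj (addIr 1)) /= /Sc /Ss 2!mulr_suml -sumrB.
  by apply: eq_bigr => k _; rewrite mulrDl mul1r (trig_cD trig).
have Es : Ss = Ss * c x + Sc * s x.
  rewrite {1}/Ss (reindex_inj (addIr 1)) /= /Sc /Ss 2!mulr_suml -big_split /=.
  by apply: eq_bigr => k _; rewrite mulrDl mul1r (trig_sD trig).
have c1 : (1 - c x) != 0 by rewrite subr_eq0 eq_sym (trig_c_neq1 trig).
have : ((1 - c x) ^+ 2 + s x ^+ 2) * Sc = 0.
  have -> : ((1 - c x) ^+ 2 + s x ^+ 2) * Sc
      = (1 - c x) * (Sc - (Sc * c x - Ss * s x))
        - s x * (Ss - (Ss * c x + Sc * s x)) by ring.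
  by rewrite -Ec -Es; ring.
move/eqP; rewrite mulf_eq0 => /orP[|/eqP //].
rewrite paddr_eq0 ?sqr_ge0 // => /andP[]; rewrite expf_eq0 /=.
by rewrite (negbTE c1).
Qed.

(** For symmetric f this is the quadratic form of A_H + 14. Two edges of a triangle share exactly
    one vertex v, so the first sum is that of A_H; the second meets each edge twice, hence the
    factor 7. *)
Definition edge_form (f : 'I_n.+2 -> 'I_n.+2 -> R) : R :=
  \sum_v \sum_(a | S a) \sum_(b | S b && S (a - b)) f v (v + a) * f v (v + b)
  + 7 * \sum_v \sum_(a | S a) f v (v + a) ^+ 2.

Definition mode_form (k : 'I_n.+2) (y : 'I_n.+2 -> R) : R :=
  \sum_(a | S a) \sum_(b | S b && S (a - b)) c (k * (a - b)) * y a * y b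
  + 7 * \sum_(a | S a) y a ^+ 2.

Section Scaling.
Variables g h : 'I_n.+2.
Hypothesis gh1 : g * h = 1.
Hypothesis S_g : forall x, S (g * x) = S x.

Let hgK : cancel ( *%R g) ( *%R h).
Proof. by move=> a; rewrite mulrA [h * g]mulrC gh1 mul1r. Qed.

Lemma scaled_sum (F : 'I_n.+2 -> R) :
  \sum_(a | S a) F (h * a) = \sum_(a | S a) F a.
Proof.
rewrite (reindex_inj (can_inj hgK)) /=.
by apply: eq_big => a; rewrite ?S_g ?hgK.
Qed.

Lemma scaled_sum_cond (P : pred 'I_n.+2) (F : 'I_n.+2 -> R) :
  \sum_(a | S a && P a) F (h * a) = \sum_(a | S a && P (g * a)) F a.
Proof.
rewrite (reindex_inj (can_inj hgK)) /=.
by apply: eq_big => a; rewrite ?S_g ?hgK.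
Qed.

(** Multiplication by a unit that preserves S is an automorphism of the Cayley graph and permutes
    the characters, so one k from each orbit suffices. *)
Lemma scaled_mode_form k y :
  mode_form (g * k) y = mode_form k (fun a => y (h * a)).
Proof.
rewrite /mode_form; congr (_ + 7 * _);
  rewrite [RHS](reindex_inj (can_inj hgK)) /=.
  apply: eq_big => [a|a _]; rewrite ?S_g //.
  rewrite [RHS](reindex_inj (can_inj hgK)) /=.
  apply: eq_big => [b|b _]; rewrite -?mulrBr ?S_g // !hgK.
  by rewrite mulrA [g * k]mulrC.
by apply: eq_big => [a|a _]; rewrite ?S_g ?hgK.
Qed.

End Scaling.

Variable f : 'I_n.+2 -> 'I_n.+2 -> R.
Hypothesis f_sym : forall u v, f u v = f v u.

(* An edge [{v, v + a}] is paired with the character at twice its midpoint,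
   which makes the transform independent of the orientation. *)
Definition mode (t : 'I_n.+2 -> R) (k a : 'I_n.+2) : R :=
  \sum_v f v (v + a) * t (k * (v + (v + a))).

Lemma mode_opp t k a : mode t k (- a) = mode t k a.
Proof.
rewrite /mode (reindex_inj (addIr a)) /=; apply: eq_bigr => v _.
by rewrite addrK f_sym [v + a + v]addrC.
Qed.

Lemma trig_cB x y : c (x - y) = c x * c y + s x * s y.
Proof. by rewrite (trig_cD trig) (trig_cN trig) (trig_sN trig); ring. Qed.

Lemma trig_sB x y : s (x - y) = s x * c y - c x * s y.
Proof. by rewrite (trig_sD trig) (trig_cN trig) (trig_sN trig); ring. Qed.

(** Expanded by the subtraction formulas, the right side becomes a sum over v and w of cosines at 2
    k (v - w). Summing over k leaves only v = w, since doubling is injective. *)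
Lemma parseval_pair a b :
  n.+2%:R * \sum_v f v (v + a) * f v (v + b)
    = \sum_k (c (k * (a - b))
                * (mode c k a * mode c k b + mode s k a * mode s k b)
              + s (k * (a - b))
                * (mode s k a * mode c k b - mode c k a * mode s k b)).
Proof.
transitivity (\sum_k \sum_v \sum_w
    f v (v + a) * f w (w + b) * c (k * ((v - w) + (v - w)))); last first.
  apply: eq_bigr => k _; rewrite /mode !mulr_suml -!big_split /=.
  rewrite -sumrB !mulr_sumr -big_split /=; apply: eq_bigr => v _.
  rewrite !mulr_sumr -!big_split /= -sumrB !mulr_sumr -big_split /=.
  apply: eq_bigr => w _.
  have -> : k * (v - w + (v - w))
      = (k * (v + (v + a)) - k * (w + (w + b))) - k * (a - b) by ring.
  by rewrite trig_cB [c (_ - _)]trig_cB [s (_ - _)]trig_sB; ring.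
rewrite exchange_big mulr_sumr; apply: eq_bigr => v _ /=.
rewrite exchange_big (bigD1 v) //= [X in _ = _ + X]big1 => [|w wv].
  by rewrite addr0 -mulr_sumr sum_trig subrr addr0 eqxx mulr1 mulrC.
rewrite -mulr_sumr sum_trig; case: eqP => [/double_inj /eqP|_].
  by rewrite subr_eq0 eq_sym (negbTE wv).
by rewrite !mulr0.
Qed.

Lemma parseval_edge_form :
  n.+2%:R * edge_form f
    = \sum_k (mode_form k (mode c k) + mode_form k (mode s k)).
Proof.
rewrite /edge_form mulrDr.
have -> : n.+2%:R * (7 * \sum_v \sum_(a | S a) f v (v + a) ^+ 2)
    = \sum_k 7 * (\sum_(a | S a) mode c k a ^+ 2
                  + \sum_(a | S a) mode s k a ^+ 2).
  rewrite mulrCA -mulr_sumr exchange_big /=; congr (_ * _).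
  rewrite mulr_sumr.
  under [RHS]eq_bigr => k _ do rewrite -big_split /=.
  rewrite [RHS]exchange_big; apply: eq_bigr => a _ /=.
  under eq_bigr => v _ do rewrite expr2.
  rewrite parseval_pair; apply: eq_bigr => k _.
  by rewrite subrr mulr0 (trig_c0 trig); ring.
have -> : n.+2%:R * (\sum_v \sum_(a | S a) \sum_(b | S b && S (a - b))
                       f v (v + a) * f v (v + b))
    = \sum_k \sum_(a | S a) \sum_(b | S b && S (a - b))
        c (k * (a - b)) * (mode c k a * mode c k b + mode s k a * mode s k b)
      + \sum_k \sum_(a | S a) \sum_(b | S b && S (a - b))
        s (k * (a - b)) * (mode s k a * mode c k b - mode c k a * mode s k b).
  rewrite exchange_big mulr_sumr /= [X in _ = X + _]exchange_big.
  rewrite [X in _ = _ + X]exchange_big -big_split /=.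
  apply: eq_bigr => a Sa.
  rewrite exchange_big mulr_sumr /= [X in _ = X + _]exchange_big.
  rewrite [X in _ = _ + X]exchange_big -big_split /=.
  apply: eq_bigr => b _.
  by rewrite parseval_pair big_split.
have -> : \sum_k \sum_(a | S a) \sum_(b | S b && S (a - b))
    s (k * (a - b)) * (mode s k a * mode c k b - mode c k a * mode s k b) = 0.
  rewrite big1 // => k _; set X := \sum_(a | _) _.
  (* Replacing a and b by - a and - b negates the sine and fixes the modes, which are even. *)
  suff : X = - X by move: X => X; lra.
  rewrite {1}/X (reindex_inj oppr_inj) /= /X -sumrN.
  under eq_bigl => a do rewrite S_opp.
  apply: eq_bigr => a _; rewrite (reindex_inj oppr_inj) /= -sumrN.
  under eq_bigl => b do rewrite S_opp -opprD S_opp.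
  apply: eq_bigr => b _; rewrite -opprD mulrN (trig_sN trig) !mode_opp; ring.
rewrite addr0 -big_split /=; apply: eq_bigr => k _; rewrite /mode_form.
rewrite mulrDr addrACA; congr (_ + _); rewrite -big_split /=.
apply: eq_bigr => a _; rewrite -big_split /=; apply: eq_bigr => b _; ring.
Qed.

Lemma edge_form_lower_bound (eps : R) :
  (forall k, eps * \sum_(a | S a) mode c k a ^+ 2 <= mode_form k (mode c k)) ->
  (forall k, eps * \sum_(a | S a) mode s k a ^+ 2 <= mode_form k (mode s k)) ->
  eps * \sum_v \sum_(a | S a) f v (v + a) ^+ 2 <= edge_form f.
Proof.
move=> hc hs; rewrite -(ler_pM2l (_ : 0 < n.+2%:R)) ?ltr0n //.
rewrite parseval_edge_form mulrCA exchange_big mulr_sumr /=.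
under eq_bigr => a _.
  under eq_bigr => v _ do rewrite expr2.
  rewrite parseval_pair.
  under eq_bigr => k _ do
    rewrite subrr mulr0 (trig_c0 trig) mul1r [mode s k a * mode c k a]mulrC
      subrr mulr0 addr0.
  over.
rewrite exchange_big mulr_sumr /=; apply: ler_sum => k _.
rewrite big_split mulrDr; apply: lerD.
  by under eq_bigr => a _ do rewrite -expr2; exact: hc.
by under eq_bigr => a _ do rewrite -expr2; exact: hs.
Qed.

End Fourier.

(** * Lower bounds for the Fourier modes *)

Local Arguments Z.add : simpl never.
Local Arguments Z.sub : simpl never.
Local Arguments Z.mul : simpl never.
Local Arguments Z.opp : simpl never.

Lemma zr_mod (n : nat) (x : Z) :
  zr x = (Z.to_nat (x mod Z.of_nat n.+2)%bZ)%:R :> 'I_n.+2.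
Proof.
rewrite -zr_nat Z2Nat.id; last by apply: (Z.mod_pos_bound _ _ _).1; lia.
rewrite {1}(Z.div_mod x (Z.of_nat n.+2)); last by lia.
rewrite zrD zrM [zr (Z.of_nat _)]zr_nat (_ : n.+2%:R = 0) ?mul0r ?add0r //.
by rewrite Zp_nat; apply: val_inj; rewrite /= modnn.
Qed.

Lemma val_zr (n : nat) (x : Z) :
  val (zr x : 'I_n.+2) = Z.to_nat (x mod Z.of_nat n.+2)%bZ.
Proof.
rewrite zr_mod Zp_nat /= modn_small //.
have := Z.mod_pos_bound x (Z.of_nat n.+2); lia.
Qed.

Lemma zr_of_nat_ord (n : nat) (x : 'I_n.+2) : zr (Z.of_nat x) = x.
Proof. by rewrite zr_nat natr_Zp. Qed.

Local Notation Z785 := 'I_783.+2.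

Lemma of_nat_val_zr (x : Z) : Z.of_nat (zr x : Z785) = zp x.
Proof.
rewrite val_zr Z2Nat.id //; apply: (Z.mod_pos_bound _ _ _).1; lia.
Qed.

Lemma zp_zp x : zp (zp x) = zp x.
Proof. exact: Z.mod_mod. Qed.

Definition conn (x : Z785) : bool := connz (Z.of_nat x).

Lemma conn_zr x : conn (zr x) = connz x.
Proof. by rewrite /conn of_nat_val_zr /connz zp_zp. Qed.

Lemma mem_zrange (n : nat) (x : Z) :
  (0 <= x < Z.of_nat n)%bZ -> x \in zrange n.
Proof.
move=> x_n; rewrite -[x]Z2Nat.id; last by case: x_n.
by rewrite map_f // mem_iota; lia.
Qed.

Lemma all_zrange (P : pred Z) (x : Z) : all P (zrange 785) -> P (zp x).
Proof. by move/allP; apply; apply/mem_zrange/Z.mod_pos_bound. Qed.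

Lemma all_Z785 (P : pred Z) : all P (zrange 785) ->
  forall x : Z785, P (Z.of_nat x).
Proof.
by move=> h x; rewrite -[x]zr_of_nat_ord of_nat_val_zr; exact: all_zrange.
Qed.

Lemma conn_opp x : conn (- x) = conn x.
Proof.
rewrite -[x]zr_of_nat_ord -zrN !conn_zr.
have h : all (fun x => connz (- x)%bZ == connz x) (zrange 785).
  by vm_cast_no_check (erefl true).
exact/eqP/(all_Z785 h x).
Qed.

Lemma conn_mul53 x : conn (zr 53 * x) = conn x.
Proof.
rewrite -[x]zr_of_nat_ord -zrM !conn_zr.
have h : all (fun x => connz (53 * x)%bZ == connz x) (zrange 785).
  by vm_cast_no_check (erefl true).
exact/eqP/(all_Z785 h x).
Qed.

Lemma zr785 : zr 785 = 0 :> Z785.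
Proof. by apply: val_inj; rewrite val_zr. Qed.

Lemma sum_conn_list (V : nmodType) (F : Z785 -> V) :
  \sum_(a | conn a) F a = \sum_(i <- conn_list) F (zr i).
Proof.
have -> : conn_list = [seq x <- zrange 785 | connz x].
  by vm_cast_no_check (erefl conn_list).
rewrite big_filter big_map -[iota 0 785]/(index_iota 0 785) big_mkord.
by apply: eq_big => x; rewrite ?zr_of_nat_ord.
Qed.

Lemma sum_conn (V : nmodType) (F : Z785 -> V) :
  \sum_(a | conn a) F a = \sum_(i <- reps) (F (zr i) + F (- zr i)).
Proof.
have h : perm_eq conn_list (reps ++ [seq (785 - i)%bZ | i <- reps]).
  by vm_cast_no_check (erefl true).
rewrite sum_conn_list (perm_big _ h) big_cat big_map big_split.
congr (_ + _); apply: eq_bigr => i _; congr F.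
by rewrite zrB zr785 sub0r.
Qed.

Section ModeBound.
Variables (R : realFieldType) (c : Z785 -> R).
Hypothesis cN : forall x, c (- x) = c x.
Hypothesis cos_approx : forall x, `|2 ^+ 22 * c (zr x) - zr (cosz x)| <= 5.

(** Each term is at least - (e / 2) (z_i^2 + z_j^2). *)
Lemma weighted_sum_bound (I : Type) (r : seq I) (w : I -> I -> R)
    (z : I -> R) (e : R) :
  (forall i j, `|w i j| <= e) ->
  - (e * (size r)%:R * \sum_(i <- r) z i ^+ 2)
    <= \sum_(i <- r) \sum_(j <- r) w i j * z i * z j.
Proof.
move=> we.
have -> : - (e * (size r)%:R * \sum_(i <- r) z i ^+ 2)
    = \sum_(i <- r) \sum_(j <- r) - (e / 2) * (z i ^+ 2 + z j ^+ 2).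
  under [RHS]eq_bigr => i _.
    rewrite -mulr_sumr big_split /= big_const_seq count_predT iter_addr_0.
    over.
  rewrite -mulr_sumr big_split /= big_const_seq count_predT iter_addr_0.
  rewrite sumrMnl; set t := \sum_(i <- r) _.
  by rewrite -[t *+ _]mulr_natr; field.
apply: ler_sum => i _; apply: ler_sum => j _.
have := we i j; rewrite ler_norml => /andP[h1 h2].
have : 0 <= (z i + z j) ^+ 2 by exact: sqr_ge0.
have : 0 <= (z i - z j) ^+ 2 by exact: sqr_ge0.
by nra.
Qed.

Definition same (a b : Z785) : bool := same_side (Z.of_nat a) (Z.of_nat b).

Lemma same_zr x y : same (zr x) (zr y) = same_side x y.
Proof.
rewrite /same !of_nat_val_zr /same_side /zp.
have sqE t : ((t mod 785) * (t mod 785) mod 5 = t * t mod 5)%bZ.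
  rewrite Z.mul_mod // (_ : (t mod 785) mod 5 = t mod 5)%bZ -?Z.mul_mod //.
  by rewrite Z.mod_mod_divide //; exists 157%bZ.
by rewrite !sqE.
Qed.

Lemma uniq_reps : uniq reps.
Proof. by vm_cast_no_check (erefl true). Qed.

(** Lowering 14 to 13.8 leaves 0.2 to spare on each variable. The target takes 2/16 of it, and the
    rest exceeds the error of the cosine table, at most 20 units of 2^-22 on each of the 78 entries
    of a row. The penalty vanishes at y by hypothesis. *)
Lemma mode_form_bound (pen : bool) (k : Z) (y : Z785 -> R) :
  spectral_check pen k -> (forall a, y (- a) = y a) ->
  (pen -> forall i, \sum_(j <- reps | same_side i j) y (zr j) = 0) ->
  16^-1 * \sum_(a | conn a) y a ^+ 2 <= mode_form c conn (zr k) y.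
Proof.
move=> chk yN ypen.
pose z i := y (zr i).
pose g (t : Z785) := if conn t then c (zr k * t) else 0.
have gN t : g (- t) = g t by rewrite /g conn_opp mulrN cN.
have ssq : \sum_(a | conn a) y a ^+ 2 = 2 * \sum_(i <- reps) z i ^+ 2.
  rewrite sum_conn mulr_sumr; apply: eq_bigr => i _.
  by rewrite yN -/(z i); ring.
(* As y is even, the pairs {a, - a} can be folded: among the four differences of signed i and j, i -
   j and i + j each occur twice up to sign. *)
have -> : mode_form c conn (zr k) y
    = \sum_(i <- reps) \sum_(j <- reps)
        2 * (g (zr (i - j)%bZ) + g (zr (i + j)%bZ)) * z i * z j
      + 14 * \sum_(i <- reps) z i ^+ 2.
  rewrite /mode_form ssq; congr (_ + _); last by ring.
  transitivity (\sum_(a | conn a) \sum_(b | conn b) g (a - b) * y a * y b).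
    apply: eq_bigr => a _; rewrite big_mkcondr; apply: eq_bigr => b _.
    by rewrite /g; case: ifP => _; rewrite ?mul0r.
  rewrite sum_conn; apply: eq_bigr => i _; rewrite !sum_conn -big_split /=.
  apply: eq_bigr => j _; rewrite !yN -/(z i) -/(z j) opprK.
  rewrite [- zr i + zr j]addrC -[zr j - zr i]opprB gN.
  by rewrite -[- zr i - zr j]opprD gN zrB zrD; ring.
have szr : size reps = 78 by [].
have gabs i j : g (zr (Z.abs (i - j))) = g (zr (i - j)%bZ).
  case: (Z.abs_spec (i - j)) => -[_ ->] //.
  by rewrite zrN gN.
pose e t : Z := if connz t then (2 * cosz (k * t))%bZ else 0%bZ.
pose d : Z := (13 * 2 ^ 22 + 2 ^ 22 * 8 / 10)%bZ.
have eE t : `|2 ^+ 22 * (2 * g (zr t)) - zr (e t)| <= 10.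
  rewrite /g /e conn_zr; case: ifP => _; last first.
    by rewrite !mulr0 zr0 subrr normr0 ler0n.
  have := cos_approx (k * t)%bZ; rewrite !zrM !ler_norml [zr 2](_ : _ = 2) //.
  move: (2 ^+ 22) (c _) (zr (cosz _)) => K x y'.
  by move=> /andP[h1 h2]; clear -h1 h2; apply/andP; split; lra.
pose w i j := zr (e (Z.abs (i - j))) + zr (e (i + j)%bZ)
  - 2 ^+ 22 * (2 * (g (zr (i - j)%bZ) + g (zr (i + j)%bZ))) : R.
have we i j : `|- w i j| <= 20.
  have := eE (Z.abs (i - j)); have := eE (i + j)%bZ.
  rewrite /w gabs !ler_norml.
  move: (2 ^+ 22) (zr (e _)) (zr (e _)) (g _) (g _) => K x1 x2 x3 x4.
  move=> /andP[h1 h2] /andP[h3 h4].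
  by clear -h1 h2 h3 h4; apply/andP; split; lra.
have /(_ z) := @weighted_sum_bound Z reps _ _ 20 we; rewrite szr => err.
have diag : \sum_(i <- reps) \sum_(j <- reps)
    (if (i =? j)%bZ then zr d else 0) * z i * z j
    = zr d * \sum_(i <- reps) z i ^+ 2.
  rewrite mulr_sumr; apply: eq_big_seq => i ri.
  rewrite (bigD1_seq i) ?uniq_reps //= Z.eqb_refl big1 => [|j /eqP ji].
    by ring.
  by case: Z.eqb_spec => [ij|_]; [case: ji | rewrite !mul0r].
have penalty : \sum_(i <- reps) \sum_(j <- reps)
    (if pen && same_side i j then 2 ^+ 22 else 0) * z i * z j = 0.
  apply: big1 => i _; case: pen ypen {chk} => [/(_ isT i) h|_] /=; last first.
    by apply: big1 => j _; rewrite !mul0r.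
  transitivity (2 ^+ 22 * z i * \sum_(j <- reps | same_side i j) z j).
    rewrite [in RHS]big_mkcond mulr_sumr; apply: eq_bigr => j _.
    by case: ifP; rewrite ?mulr0 ?mul0r.
  by rewrite h mulr0.
have zr22 : zr (2 ^ 22)%bZ = 2 ^+ 22 :> R by exact: (@zrX R 2 22).
have psd : 0 <= \sum_(i <- reps) \sum_(j <- reps)
    zr (spectral_entry pen k i j) * z i * z j.
  apply: (chol_psd z _ (chk : chol_check (size reps) _)) => i j.
  rewrite /spectral_entry /same_side.
  have -> : Z.abs (i - j) = Z.abs (j - i) by lia.
  rewrite [(i + j)%bZ]Z.add_comm [(i =? j)%bZ]Z.eqb_sym.
  by rewrite [((i * i) mod 5 =? _)%bZ]Z.eqb_sym.
have entryE i j : zr (spectral_entry pen k i j) * z i * z j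
    = - (- w i j * z i * z j)
      + 2 ^+ 22 * (2 * (g (zr (i - j)%bZ) + g (zr (i + j)%bZ)) * z i * z j)
      + (if (i =? j)%bZ then zr d else 0) * z i * z j
      + (if pen && same_side i j then 2 ^+ 22 else 0) * z i * z j.
  have -> : zr (spectral_entry pen k i j)
      = zr (e (Z.abs (i - j))) + zr (e (i + j)%bZ)
        + zr (if (i =? j)%bZ then d else 0%bZ)
        + zr (if pen && same_side i j then (2 ^ 22)%bZ else 0%bZ) :> R.
    by rewrite -!zrD.
  have -> : zr (if (i =? j)%bZ then d else 0%bZ)
      = (if (i =? j)%bZ then zr d else 0) :> R by case: ifP.
  have -> : zr (if pen && same_side i j then (2 ^ 22)%bZ else 0%bZ)
      = (if pen && same_side i j then 2 ^+ 22 else 0) :> R.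
    by case: ifP => _; rewrite ?zr22 ?zr0.
  by rewrite /w; ring.
move: psd; under eq_bigr => i _.
  under eq_bigr => j _ do rewrite entryE.
  rewrite !big_split /= sumrN -mulr_sumr.
  over.
rewrite !big_split /= sumrN -mulr_sumr diag penalty addr0.
have dle : zr d <= 2 ^+ 22 * (138 / 10) :> R.
  have /(@zr_le R) : (10 * d <= 138 * 2 ^ 22)%bZ by vm_compute.
  rewrite [zr (10 * d)]zrM [zr (138 * _)]zrM zr22.
  rewrite [zr 10](_ : _ = 10) // [zr 138](_ : _ = 138) //.
  by move: (2 ^+ 22) (zr d) => K x h; clear -h; lra.
have sq0 : 0 <= \sum_(i <- reps) z i ^+ 2.
  by apply: sumr_ge0 => i _; exact: sqr_ge0.
have := ler_wpM2r sq0 dle; move: err sq0; rewrite ssq.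
have : 2 ^+ 22 = 4 * 1024 * 1024 :> R by ring.
move: (2 ^+ 22) => K ->.
set sq := \sum_(i <- reps) _; set e1 := \sum_(i <- reps) _.
set e2 := \sum_(i <- reps) _.
by move=> h1 h2 h3 h4; clear -h1 h2 h3 h4; lra.
Qed.

End ModeBound.

Opaque zr.

Lemma zr_zp x : zr (zp x) = zr x :> Z785.
Proof. by rewrite -of_nat_val_zr zr_of_nat_ord. Qed.

(** * Orbits of the characters under multiplication by 53 *)

Lemma same_mul53 a b : same (zr 53 * a) (zr 53 * b) = same a b.
Proof.
rewrite -[a]zr_of_nat_ord -[b]zr_of_nat_ord -!zrM !same_zr /same_side.
move: (Z.of_nat a) (Z.of_nat b) => x y.
have mul9 t : ((53 * t) * (53 * t) mod 5 = 4 * (t * t mod 5) mod 5)%bZ.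
  (* Here 53^2 = 2809 = 4 + 5 * 561. *)
  rewrite Z.mul_mod_idemp_r // -(Z.mod_add (4 * _) (561 * (t * t)) 5) //.
  by f_equal; lia.
rewrite !mul9.
have := Z.mod_pos_bound (x * x) 5 ltac:(lia).
have := Z.mod_pos_bound (y * y) 5 ltac:(lia).
move: ((x * x) mod 5)%bZ ((y * y) mod 5)%bZ => u v hv hu.
have h : all (fun u => all (fun v =>
    ((4 * u) mod 5 =? (4 * v) mod 5)%bZ == (u =? v)%bZ) (zrange 5)) (zrange 5).
  by [].
by have /allP/(_ v (@mem_zrange 5 _ hv))/eqP := allP h u (@mem_zrange 5 _ hu).
Qed.

Lemma same_opp a b : same a (- b) = same a b.
Proof.
rewrite -[a]zr_of_nat_ord -[b]zr_of_nat_ord -zrN !same_zr /same_side.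
by rewrite Z.mul_opp_opp.
Qed.

Lemma spectral_check_penalized : all (spectral_check true) [:: 0; 157]%bZ.
Proof. by vm_cast_no_check (erefl true). Qed.

Lemma spectral_check_plain : all (spectral_check false) [:: 1; 3; 5; 7; 21]%bZ.
Proof. by vm_cast_no_check (erefl true). Qed.

Definition orbits : seq Z :=
  Eval vm_compute in
  flatten [seq traject mul53 k 156 | k <- [:: 0; 157; 1; 3; 5; 7; 21]%bZ].

(** The orbits are {0}, the nonzero multiples of 157, those of 5, and the four cosets of the
    subgroup in the 624 units, represented by 1, 3, 7 and 21. *)
Lemma orbit_reps (k : Z785) : exists2 k0 : Z,
  k0 \in [:: 0; 157; 1; 3; 5; 7; 21]%bZ & exists i, k = zr (iter i mul53 k0).
Proof.
have h : all (fun x => has (Z.eqb x) orbits) (zrange 785).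
  by vm_cast_no_check (erefl true).
have orbitsE : orbits
    = flatten [seq traject mul53 k0 156 | k0 <- [:: 0; 157; 1; 3; 5; 7; 21]%bZ].
  by vm_cast_no_check (erefl orbits).
have /hasP[x] := all_Z785 h k; rewrite orbitsE => /flatten_mapP[k0 k0in].
move=> /trajectP[i _ ->] /Z.eqb_eq ki; exists k0; first exact: k0in.
by exists i; rewrite -[LHS]zr_of_nat_ord; exact: (congr1 zr ki).
Qed.

Opaque conn same.

Section AllModes.
Variables (R : realFieldType) (c : Z785 -> R).
Hypothesis cN : forall x, c (- x) = c x.
Hypothesis cos_approx : forall x, `|2 ^+ 22 * c (zr x) - zr (cosz x)| <= 5.

(** This is what orthogonality to the pullbacks from K5 imposes on a mode with 5 k = 0; it is the
    condition under which the penalty vanishes. *)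
Definition balanced (y : Z785 -> R) : Prop :=
  forall b, \sum_(a | conn a && same b a) y a = 0.

Lemma balanced_reps y i : (forall a, y (- a) = y a) -> balanced y ->
  \sum_(j <- reps | same_side i j) y (zr j) = 0.
Proof.
move=> yN /(_ (zr i)); rewrite big_mkcondr sum_conn.
set s1 := \sum_(j <- reps) _ => h; rewrite big_mkcond.
set s2 := \sum_(j <- reps) _.
suff : s1 = 2 * s2 by move: h; move: s1 s2 => x1 x2 h1 h2; lra.
rewrite /s1 /s2 mulr_sumr; apply: eq_bigr => j _.
by rewrite same_opp same_zr yN; case: ifP => _; ring.
Qed.

Lemma mul53_237 : zr 53 * zr 237 = 1 :> Z785.
Proof. by rewrite -zrM; apply: val_inj; rewrite val_zr. Qed.

(** Induction along the orbit: a factor 53 in k is moved into y as multiplication by 237, the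
    inverse of 53, which preserves evenness and balance. *)
Lemma mode_form_lower_bound k y : (forall a, y (- a) = y a) ->
  (zr 5 * k = 0 -> balanced y) ->
  16^-1 * \sum_(a | conn a) y a ^+ 2 <= mode_form c conn k y.
Proof.
have [k0 k0in [i ->]] := orbit_reps k.
elim: i y => [|i IH] y yN ybal; rewrite ?iterS /=.
  have := spectral_check_penalized; have := spectral_check_plain.
  have [k0pen _ /allP/(_ k0 k0pen) chk|/negbTE k0pen /allP chk _] :=
    boolP (k0 \in [:: 0; 157]%bZ).
    apply: (mode_form_bound cN cos_approx chk yN) => _ j.
    apply: balanced_reps => //; apply: ybal; rewrite -zrM -zr_zp.
    by move: k0pen; rewrite !inE => /orP[] /eqP ->.
  have /chk {}chk : k0 \in [:: 1; 3; 5; 7; 21]%bZ.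
    move: k0pen k0in; rewrite !inE => /negbT; rewrite negb_or.
    by move=> /andP[/negbTE -> /negbTE ->].
  exact: (mode_form_bound cN cos_approx chk yN).
rewrite zr_zp zrM.
rewrite (scaled_mode_form _ mul53_237 conn_mul53).
rewrite -(scaled_sum mul53_237 conn_mul53 (fun a => y a ^+ 2)).
apply: IH => [a|k5 b]; first by rewrite mulrN yN.
rewrite (scaled_sum_cond mul53_237 conn_mul53).
rewrite -[b]mul1r -mul53_237 -mulrA.
under eq_bigl => a do rewrite same_mul53.
by apply: ybal; rewrite zr_zp zrM mulrCA k5 mulr0.
Qed.

End AllModes.

(** * Colorings and their averages over the classes *)

Section Pullback.
Variables (R : realFieldType) (I K : finType) (E : rel I) (cls : I -> K).
Hypothesis E_sym : symmetric E.
Hypothesis E_cls : forall u v, E u v -> cls u != cls v.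
Hypothesis card_K : #|K| = 5.

Let e u v : R := (E u v)%:R.
Let tri v u w : R := e v u * e v w * e u w.

Definition class_sum (f : I -> I -> R) (r t : K) : R :=
  \sum_(v | cls v == r) \sum_(u | cls u == t) e v u * f v u.

Definition triangle_form (f g : I -> I -> R) : R :=
  \sum_v \sum_u \sum_w tri v u w * f v u * g v w.

Definition edge_pairing (f g : I -> I -> R) : R :=
  \sum_v \sum_u e v u * f v u * g v u.

Hypothesis class_degree : forall v u t, E v u ->
  \sum_(w | cls w == t) e v w * e u w
    = 7 * ((t != cls v) && (t != cls u))%:R.
Variable N : R.
Hypothesis N_gt0 : 0 < N.
Hypothesis class_size : forall r t,
  class_sum (fun _ _ => 1) r t = N * (r != t)%:R.

Lemma e_sym u v : e u v = e v u.
Proof. by rewrite /e E_sym. Qed.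

Lemma eT u v : E u v -> e u v = 1.
Proof. by rewrite /e => ->. Qed.

Lemma eF u v : ~~ E u v -> e u v = 0.
Proof. by rewrite /e => /negbTE ->. Qed.

Lemma e_sqr_ge0 u v (a : R) : 0 <= e u v * a * a.
Proof. by rewrite -mulrA mulr_ge0 ?ler0n // -expr2 sqr_ge0. Qed.

Lemma sum_by_class (f : I -> I -> R) (G : K -> K -> R) :
  \sum_v \sum_u e v u * f v u * G (cls v) (cls u)
    = \sum_r \sum_t G r t * class_sum f r t.
Proof.
rewrite (partition_big cls predT) //=; apply: eq_bigr => r _.
under eq_bigr => v _ do rewrite (partition_big cls predT) //=.
rewrite exchange_big /=; apply: eq_bigr => t _.
rewrite /class_sum mulr_sumr; apply: eq_bigr => v /eqP <-.
by rewrite mulr_sumr; apply: eq_bigr => u /eqP <-; rewrite mulrC.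
Qed.

Lemma class_sum_sym f : (forall u v, f u v = f v u) ->
  forall r t, class_sum f r t = class_sum f t r.
Proof.
move=> f_sym r t; rewrite /class_sum exchange_big /=.
by apply: eq_bigr => u _; apply: eq_bigr => v _; rewrite e_sym f_sym.
Qed.

Lemma class_sum_diag f r : class_sum f r r = 0.
Proof.
rewrite /class_sum big1 // => v /eqP vr; rewrite big1 // => u /eqP ur.
rewrite /e; case: (boolP (E v u)) => [/E_cls|_]; last by rewrite mul0r.
by rewrite vr ur eqxx.
Qed.

Lemma triangle_form_sym f g : triangle_form f g = triangle_form g f.
Proof.
rewrite /triangle_form; apply: eq_bigr => v _; rewrite exchange_big /=.
apply: eq_bigr => u _; apply: eq_bigr => w _.
by rewrite /tri [e w u]e_sym; ring.
Qed.

(** An edge has seven common neighbours in every class other than those of its ends. The class of v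
    drops out because G vanishes there. *)
Lemma common_neighbours v u (G : K -> R) : E v u -> G (cls v) = 0 ->
  \sum_w e v w * e u w * G (cls w) = 7 * (\sum_t G t - G (cls u)).
Proof.
move=> vu G0; rewrite (partition_big cls predT) //=.
have -> : \sum_t G t - G (cls u)
    = \sum_t ((t != cls v) && (t != cls u))%:R * G t.
  rewrite [in LHS](bigD1 (cls u)) //= addrAC subrr add0r big_mkcond /=.
  apply: eq_bigr => t _; case: eqP => [->|_] /=.
    by rewrite andbF mul0r.
  by case: eqP => [->|_]; rewrite ?G0 ?mulr0 ?mul1r.
rewrite mulr_sumr; apply: eq_bigr => t _.
rewrite mulrA -class_degree // mulr_suml.
by apply: eq_bigr => w /eqP <-.
Qed.

(** On pullbacks A_H + 14 acts as 7 (A + 2), where A belongs to the line graph of K5. Since A + 2 =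
    B^T B for the vertex-edge incidence matrix B of K5, the form pairs the sums at the vertices of
    K5. *)
Lemma triangle_form_class f (G : K -> K -> R) : (forall r, G r r = 0) ->
  triangle_form f (fun v w => G (cls v) (cls w))
    + 7 * edge_pairing f (fun v w => G (cls v) (cls w))
  = 7 * \sum_r (\sum_t G r t) * \sum_t class_sum f r t.
Proof.
move=> G0.
transitivity (7 * \sum_v \sum_u e v u * f v u * \sum_t G (cls v) t); last first.
  rewrite (sum_by_class f (fun r _ => \sum_t G r t)); congr (_ * _).
  by apply: eq_bigr => r _; rewrite mulr_sumr.
rewrite /triangle_form /edge_pairing !mulr_sumr -big_split /=.
apply: eq_bigr => v _; rewrite !mulr_sumr -big_split /=.
apply: eq_bigr => u _.
have [vu|nvu] := boolP (E v u); last first.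
  by rewrite big1 => [|w _]; rewrite /tri (eF nvu); ring.
have := common_neighbours vu (G0 (cls v)) => h.
have -> : \sum_w tri v u w * f v u * G (cls v) (cls w)
    = e v u * f v u * \sum_w e v w * e u w * G (cls v) (cls w).
  by rewrite mulr_sumr; apply: eq_bigr => w _; rewrite /tri; ring.
rewrite h; ring.
Qed.

Variable x : I -> I -> R.
Hypothesis x_sym : forall u v, x u v = x v u.
Hypothesis x_sqr : forall u v, x u v ^+ 2 = 1.
Hypothesis x_tri : forall u v w, E u v -> E v w -> E u w ->
  x u v * x u w + x v u * x v w + x w u * x w v = -1.

(** The three products of edge values in a triangle sum to -1, and every edge lies in 21 triangles.
    Adding over the three choices of the common vertex, three times the triangle form is -21 times
    the number of ordered edges. *)
Lemma coloring_form0 : triangle_form x x + 7 * edge_pairing x x = 0.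
Proof.
have pairing1 : edge_pairing x x = \sum_v \sum_u e v u.
  apply: eq_bigr => v _; apply: eq_bigr => u _.
  by rewrite -mulrA -expr2 x_sqr mulr1.
have tri3 : triangle_form x x + triangle_form x x + triangle_form x x
    = - \sum_v \sum_u \sum_w tri v u w.
  rewrite {2}/triangle_form [X in _ + X + _]exchange_big /=.
  rewrite {2}/triangle_form.
  have -> : \sum_v \sum_u \sum_w tri v u w * x v u * x v w
      = \sum_v \sum_u \sum_w tri w v u * x w v * x w u.
    rewrite exchange_big /=; apply: eq_bigr => v _.
    by rewrite exchange_big.
  rewrite /triangle_form -!big_split -sumrN /=; apply: eq_bigr => v _.
  rewrite -!big_split -sumrN /=; apply: eq_bigr => u _.
  rewrite -!big_split -sumrN /=; apply: eq_bigr => w _.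
  rewrite /tri ![e w _]e_sym [e u v]e_sym.
  case: (boolP (E v u)) => vu; last by rewrite (eF vu); ring.
  case: (boolP (E v w)) => vw; last by rewrite (eF vw); ring.
  case: (boolP (E u w)) => uw; last by rewrite (eF uw); ring.
  by have := x_tri vu uw vw; rewrite !eT //; lra.
have tricount : \sum_v \sum_u \sum_w tri v u w = 21 * \sum_v \sum_u e v u.
  rewrite mulr_sumr; apply: eq_bigr => v _.
  rewrite mulr_sumr; apply: eq_bigr => u _.
  have [vu|nvu] := boolP (E v u); last first.
    by rewrite big1 => [|w _]; rewrite /tri (eF nvu); ring.
  (* This weight is 1 at all common neighbours and vanishes at the class of v, so the count is 7 *
     (4 - 1) = 21. *)
  have h := @common_neighbours v u (fun t => (t != cls v)%:R) vu.
  rewrite eqxx in h; have {h} := h erefl.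
  have -> : \sum_t (t != cls v)%:R = 4 :> R.
    have := cardC1 (cls v); rewrite card_K => K4.
    rewrite -natr_sum -[4%N]/(5.-1) -K4 -sum1_card [in RHS]big_mkcond /=.
    by congr _%:R; apply: eq_bigr => t _; rewrite !inE; case: eqP.
  rewrite eq_sym (E_cls vu) -[true%:R]/(1 : R) => h.
  transitivity (e v u * \sum_w e v w * e u w * (cls w != cls v)%:R).
    rewrite mulr_sumr; apply: eq_bigr => w _; rewrite /tri.
    have [/E_cls vw|nvw] := boolP (E v w); last by rewrite (eF nvw); ring.
    by rewrite eq_sym vw mulr1; ring.
  by rewrite h; ring.
rewrite pairing1; move: tri3; rewrite tricount.
by move: (triangle_form x x) (\sum_v _) => a b h; lra.
Qed.

Hypothesis spectral : forall f : I -> I -> R, (forall u v, f u v = f v u) ->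
  (forall r t, class_sum f r t = 0) ->
  16^-1 * edge_pairing f f <= triangle_form f f + 7 * edge_pairing f f.

(** Split x = g + f, where g averages x over the edges between two classes, and let Q be the form of
    A_H + 14. Then Q(x) = 0 and Q(x, g) = Q(g, g) >= 0, as x and g have the same class sums. Hence
    Q(f) = - Q(g, g) <= 0, and the spectral gap forces f = 0 on all edges. *)
Theorem coloring_pullback : exists G : K -> K -> R,
  forall u v, E u v -> x u v = G (cls u) (cls v).
Proof.
pose G r t := class_sum x r t / N.
have N0 : N != 0 by rewrite lt0r_neq0.
exists G.
have Gdiag r : G r r = 0 by rewrite /G class_sum_diag mul0r.
pose g v u := G (cls v) (cls u).
have g_sym u v : g u v = g v u by rewrite /g /G class_sum_sym.
have class_g r t : class_sum g r t = class_sum x r t.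
  have -> : class_sum g r t = G r t * class_sum (fun _ _ => 1) r t.
    rewrite /class_sum mulr_sumr; apply: eq_bigr => v /eqP vr.
    rewrite mulr_sumr; apply: eq_bigr => u /eqP ut.
    by rewrite /g vr ut; ring.
  rewrite class_size; have [->|rt] := eqVneq r t.
    by rewrite Gdiag class_sum_diag mul0r.
  by rewrite /G mulr1 divfK.
pose f u v := x u v - g u v.
have f_sym u v : f u v = f v u by rewrite /f x_sym g_sym.
have class_f r t : class_sum f r t = 0.
  have -> : class_sum f r t = class_sum x r t - class_sum g r t.
    rewrite /class_sum -sumrB; apply: eq_bigr => v _.
    by rewrite -sumrB; apply: eq_bigr => u _; rewrite /f; ring.
  by rewrite class_g subrr.
have tE : triangle_form f f
    = triangle_form x x - 2 * triangle_form x g + triangle_form g g.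
  have -> : triangle_form x x - 2 * triangle_form x g + triangle_form g g
      = triangle_form x x - triangle_form x g - triangle_form g x
        + triangle_form g g.
    by rewrite [triangle_form g x]triangle_form_sym; ring.
  rewrite /triangle_form -!sumrB -big_split /=; apply: eq_bigr => v _.
  rewrite -!sumrB -big_split /=; apply: eq_bigr => u _.
  rewrite -!sumrB -big_split /=; apply: eq_bigr => w _.
  by rewrite /f; ring.
have pE : edge_pairing f f
    = edge_pairing x x - 2 * edge_pairing x g + edge_pairing g g.
  rewrite /edge_pairing mulr_sumr -sumrB -big_split /=; apply: eq_bigr => v _.
  rewrite mulr_sumr -sumrB -big_split /=; apply: eq_bigr => u _.
  by rewrite /f; ring.
have xg := triangle_form_class x Gdiag.
have gg := triangle_form_class g Gdiag.
rewrite -/(triangle_form x g) -/(edge_pairing x g) in xg.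
rewrite -/(triangle_form g g) -/(edge_pairing g g) in gg.
have sumE : \sum_r (\sum_t G r t) * (\sum_t class_sum g r t)
    = \sum_r (\sum_t G r t) * (\sum_t class_sum x r t).
  apply: eq_bigr => r _; congr (_ * _); apply: eq_bigr => t _; exact: class_g.
have sum_ge0 : 0 <= \sum_r (\sum_t G r t) * (\sum_t class_sum x r t).
  apply: sumr_ge0 => r _.
  have -> : \sum_t class_sum x r t = N * \sum_t G r t.
    rewrite mulr_sumr; apply: eq_bigr => t _.
    by rewrite /G mulrC divfK.
  by rewrite mulrCA -expr2 mulr_ge0 ?sqr_ge0 // ltW.
have pf_ge0 v : 0 <= \sum_u e v u * f v u * f v u.
  by apply: sumr_ge0 => u _; exact: e_sqr_ge0.
have pf0 : edge_pairing f f = 0.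
  apply/eqP; rewrite eq_le; apply/andP; split; last exact: sumr_ge0.
  have := spectral f_sym class_f; have := coloring_form0.
  rewrite tE {2}pE; rewrite sumE in gg.
  by lra.
move=> u v uv; apply/eqP; rewrite -subr_eq0 -/(g u v) -/(f u v) -sqrf_eq0.
have /eqP := pf0; rewrite psumr_eq0 // => /allP/(_ u (mem_index_enum _))/=.
rewrite psumr_eq0 => [/allP/(_ v (mem_index_enum _))/=|w _].
  by rewrite /e uv mul1r -expr2.
exact: e_sqr_ge0.
Qed.

End Pullback.

(** * Approximation of the trigonometric functions *)

Section RotationError.
Variable F : realFieldType.
Implicit Types (x y a b c s : F).

(** The triangle inequality in the plane, squared to avoid roots; Lagrange's identity bounds the
    inner product. *)
Lemma sqr_norm_triangle x1 y1 x2 y2 a b : 0 <= a -> 0 <= b ->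
  x1 ^+ 2 + y1 ^+ 2 <= a ^+ 2 -> x2 ^+ 2 + y2 ^+ 2 <= b ^+ 2 ->
  (x1 + x2) ^+ 2 + (y1 + y2) ^+ 2 <= (a + b) ^+ 2.
Proof.
move=> a0 b0 h1 h2.
suff : x1 * x2 + y1 * y2 <= a * b by nra.
have : (x1 * x2 + y1 * y2) ^+ 2 <= (a * b) ^+ 2.
  apply: (@le_trans _ _ ((x1 ^+ 2 + y1 ^+ 2) * (x2 ^+ 2 + y2 ^+ 2))).
    rewrite -subr_ge0.
    have -> : (x1 ^+ 2 + y1 ^+ 2) * (x2 ^+ 2 + y2 ^+ 2)
      - (x1 * x2 + y1 * y2) ^+ 2 = (x1 * y2 - x2 * y1) ^+ 2 by ring.
    exact: sqr_ge0.
  by rewrite exprMn; apply: ler_pM => //; rewrite addr_ge0 ?sqr_ge0.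
have [t0|t0] := leP (x1 * x2 + y1 * y2) 0.
  by move=> _; apply: le_trans t0 _; apply: mulr_ge0.
by rewrite ler_sqr // nnegrE ?mulr_ge0 // ltW.
Qed.

(** The new error is the sum of three vectors: the error of (a, b) turned by a rotation, of length
    at most 3; the old error under a map that does not expand, at most A; and the rounding down, at
    most 2. *)
Lemma rotation_step (N c1 s1 a b c s C S C' S' A : F) : 0 < N -> 0 <= A ->
  c ^+ 2 + s ^+ 2 = 1 -> a ^+ 2 + b ^+ 2 <= N ^+ 2 ->
  `|N * c1 - a| <= 2 -> `|N * s1 - b| <= 2 ->
  N * C' <= C * a - S * b <= N * C' + N ->
  N * S' <= C * b + S * a <= N * S' + N ->
  (N * c - C) ^+ 2 + (N * s - S) ^+ 2 <= A ^+ 2 ->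
  (N * (c * c1 - s * s1) - C') ^+ 2 + (N * (s * c1 + c * s1) - S') ^+ 2
    <= (A + 5) ^+ 2.
Proof.
move=> N0 A0 cs ab da db hC hS hA.
pose p := N * c - C; pose q := N * s - S.
pose d1 := N * c1 - a; pose d2 := N * s1 - b.
have Nn0 : N != 0 by rewrite gt_eqF.
have V1 : (c * d1 - s * d2) ^+ 2 + (s * d1 + c * d2) ^+ 2 <= 3 ^+ 2.
  have -> : (c * d1 - s * d2) ^+ 2 + (s * d1 + c * d2) ^+ 2
     = (c ^+ 2 + s ^+ 2) * (d1 ^+ 2 + d2 ^+ 2) by ring.
  rewrite cs mul1r.
  by move: da db; rewrite -/d1 -/d2 !ler_norml => /andP[? ?] /andP[? ?]; nra.
have V2 : ((p * a - q * b) / N) ^+ 2 + ((p * b + q * a) / N) ^+ 2 <= A ^+ 2.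
  have -> : ((p * a - q * b) / N) ^+ 2 + ((p * b + q * a) / N) ^+ 2
     = (p ^+ 2 + q ^+ 2) * ((a ^+ 2 + b ^+ 2) / N ^+ 2) by field.
  apply: le_trans hA; rewrite ler_piMr ?addr_ge0 ?sqr_ge0 //.
  by rewrite ler_pdivrMr ?mul1r // exprn_gt0.
have V3 : ((C * a - S * b) / N - C') ^+ 2 + ((C * b + S * a) / N - S') ^+ 2
    <= 2 ^+ 2.
  have bnd u v : N * v <= u <= N * v + N -> 0 <= u / N - v <= 1.
    move=> /andP[h1 h2]; apply/andP; split.
      by rewrite subr_ge0 ler_pdivlMr // mulrC.
    by rewrite lerBlDr ler_pdivrMr // mulrDl mul1r addrC [v * N]mulrC.
  by move: (bnd _ _ hC) (bnd _ _ hS) => /andP[? ?] /andP[? ?]; nra.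
have A3 : 0 <= 3 + A by rewrite addr_ge0.
have := sqr_norm_triangle A3 (ler0n _ 2)
  (sqr_norm_triangle (ler0n _ 3) A0 V1 V2) V3.
have -> : 3 + A + 2 = A + 5 by ring.
have -> : c * d1 - s * d2 + (p * a - q * b) / N + ((C * a - S * b) / N - C')
    = N * (c * c1 - s * s1) - C' by rewrite /p /q /d1 /d2; field.
have -> : s * d1 + c * d2 + (p * b + q * a) / N + ((C * b + S * a) / N - S')
    = N * (s * c1 + c * s1) - S' by rewrite /p /q /d1 /d2; field.
by [].
Qed.

End RotationError.

Lemma IZR_zr (x : Z) : IZR x = zr x.
Proof.
have h (p : positive) : IZR (Z.pos p) = zr (Z.pos p).
  by rewrite IZRposE INRE -Pos_to_natE -zr_nat positive_nat_Z.
by case: x => [|p|p] //; rewrite -[Z.neg p]/(Z.opp (Z.pos p)) zrN -h opp_IZR.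
Qed.

Definition angle : R := Rdiv (Rmult (IZR 2) PI) (IZR 785).

Definition cosn (n : nat) : R := cos (n%:R * angle)%R.
Definition sinn (n : nat) : R := sin (n%:R * angle)%R.

Lemma cosnD m n : cosn (m + n)%N = cosn m * cosn n - sinn m * sinn n.
Proof. by rewrite /cosn natrD mulrDl cosD. Qed.

Lemma sinnD m n : sinn (m + n)%N = sinn m * cosn n + cosn m * sinn n.
Proof. by rewrite /sinn natrD mulrDl sinD. Qed.

Lemma cosn_sqr n : cosn n ^+ 2 + sinn n ^+ 2 = 1.
Proof. by rewrite addrC !expr2; exact: sin2_cos2. Qed.

Lemma angle785 : 785%:R * angle = Rmult (IZR 2) PI.
Proof.
rewrite -[785%:R]zr_nat -IZR_zr; exact: angle_mul785.
Qed.

Lemma cosn_sinn_modn n :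
  cosn (n %% 785)%N = cosn n /\ sinn (n %% 785)%N = sinn n.
Proof.
have [hc hs] := cos_sin_period_nat (n %/ 785)%N ((n %% 785)%N%:R * angle).
rewrite /cosn /sinn {2 4}(divn_eq n 785) natrD natrM mulrDl -mulrA angle785.
by rewrite addrC -hc -hs INRE.
Qed.

Definition cosZ (u : Z785) : R := cosn u.
Definition sinZ (u : Z785) : R := sinn u.

Lemma cosZ_nat n : cosZ n%:R = cosn n.
Proof. by rewrite /cosZ Zp_nat; have [] := cosn_sinn_modn n. Qed.

Lemma sinZ_nat n : sinZ n%:R = sinn n.
Proof. by rewrite /sinZ Zp_nat; have [] := cosn_sinn_modn n. Qed.

Lemma cos_trig_system : trig_system cosZ sinZ.
Proof.
have cD (x y : Z785) : cosZ (x + y) = cosZ x * cosZ y - sinZ x * sinZ y.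
  by rewrite -[x]natr_Zp -[y]natr_Zp -natrD !cosZ_nat !sinZ_nat cosnD.
have sD (x y : Z785) : sinZ (x + y) = sinZ x * cosZ y + cosZ x * sinZ y.
  by rewrite -[x]natr_Zp -[y]natr_Zp -natrD !cosZ_nat !sinZ_nat sinnD.
have c0 : cosZ 0 = 1 by rewrite /cosZ /cosn mul0r; exact: cos_0.
have s0 : sinZ 0 = 0 by rewrite /sinZ /sinn mul0r; exact: sin_0.
(* For nonzero x the representative of - x is 785 - x, so parity is not read off from [cos] and
   [sin]; it is obtained by solving the addition formulas for x + (- x) = 0. *)
have csN (x : Z785) : cosZ (- x) = cosZ x /\ sinZ (- x) = - sinZ x.
  have := cD x (- x); have := sD x (- x); rewrite subrr c0 s0.
  have : cosZ x ^+ 2 + sinZ x ^+ 2 = 1 by exact: cosn_sqr.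
  move: (cosZ x) (sinZ x) (cosZ (- x)) (sinZ (- x)) => c s c' s' h1 h2 h3.
  split.
    have -> : c' = (c ^+ 2 + s ^+ 2) * c' by rewrite h1 mul1r.
    have -> : (c ^+ 2 + s ^+ 2) * c'
        = c * (c * c' - s * s') + s * (s * c' + c * s').
      by ring.
    by rewrite -h2 -h3; ring.
  have -> : s' = (c ^+ 2 + s ^+ 2) * s' by rewrite h1 mul1r.
  have -> : (c ^+ 2 + s ^+ 2) * s'
      = c * (s * c' + c * s') - s * (c * c' - s * s').
    by ring.
  by rewrite -h2 -h3; ring.
split=> // [x|x|x x0]; [by case: (csN x) | by case: (csN x) |].
apply/eqP; apply: cos_lt1.
have a0 : Rlt 0 angle by exact: angle_gt0.
have x_gt0 : Rlt 0 x%:R.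
  by apply/RltP; rewrite ltr0n lt0n.
have x_lt : Rlt x%:R 785%:R.
  by apply/RltP; rewrite ltr_nat.
rewrite -angle785 -!RmultE; split; first exact: Rmult_lt_0_compat.
exact: Rmult_lt_compat_r.
Qed.

Lemma rotate_error n :
  (2 ^+ 32 * cosn n - zr (iter n rotate (2 ^ 32, 0)%bZ).1) ^+ 2
  + (2 ^+ 32 * sinn n - zr (iter n rotate (2 ^ 32, 0)%bZ).2) ^+ 2
    <= (n%:R * 5) ^+ 2.
Proof.
have zr32 : zr (2 ^ 32)%bZ = 2 ^+ 32 :> R by exact: (@zrX R 2 32).
have N0 : 0 < 2 ^+ 32 :> R by rewrite exprn_gt0.
elim: n => [|n IH].
  have -> : iter 0 rotate (2 ^ 32, 0)%bZ = (2 ^ 32, 0)%bZ by [].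
  rewrite [(_, _).1]/= [(_, _).2]/= zr0.
  rewrite zr32 /cosn /sinn !mul0r (cos_0 : cos 0 = 1) (sin_0 : sin 0 = 0).
  by rewrite mulr1 mulr0 !subrr expr2 mulr0 addr0.
rewrite iterS.
move: (iter n rotate _) IH => w IH.
have [hc hs] := sin_cos_angle.
have floorP x : 2 ^+ 32 * zr (x / 2 ^ 32)%bZ <= (zr x : R)
    <= 2 ^+ 32 * zr (x / 2 ^ 32)%bZ + 2 ^+ 32.
  rewrite -zr32 -zrM -zrD; apply/andP; split; apply: zr_le.
    exact: Z.mul_div_le.
  by have := Z.mul_succ_div_gt x (2 ^ 32)%bZ; lia.
have {}hc : `|2 ^+ 32 * cosn 1 - zr cos1| <= 2 :> R.
  by rewrite /cosn mul1r -IZR_zr -RpowE; apply/RleP; exact: hc.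
have {}hs : `|2 ^+ 32 * sinn 1 - zr sin1| <= 2 :> R.
  by rewrite /sinn mul1r -IZR_zr -RpowE; apply/RleP; exact: hs.
(* The rounded rotation does not expand, so errors add up instead of growing geometrically. *)
have ab : zr cos1 ^+ 2 + zr sin1 ^+ 2 <= (2 ^+ 32) ^+ 2 :> R.
  have /(@zr_le R) : (cos1 * cos1 + sin1 * sin1 <= 2 ^ 32 * 2 ^ 32)%bZ.
    by vm_compute.
  rewrite (@zrD R (cos1 * cos1)) (@zrM R cos1) (@zrM R sin1) (@zrM R (2 ^ 32)).
  rewrite zr32; move: (2 ^+ 32) (zr cos1) (zr sin1) => K p q h.
  by rewrite !expr2.
have A0 : 0 <= n%:R * 5 :> R by rewrite mulr_ge0.
have := rotation_step N0 A0 (cosn_sqr n) ab hc hs _ _ IH.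
rewrite -[n.+1]addn1 cosnD sinnD natrD mulrDl mul1r; apply.
  by have := floorP (w.1 * cos1 - w.2 * sin1)%bZ; rewrite zrB !zrM.
by have := floorP (w.1 * sin1 + w.2 * cos1)%bZ; rewrite zrD !zrM.
Qed.

Lemma nth_map_traject (A B : Type) (y : B) (h : A -> B) (f : A -> A) x n i :
  (i < n)%N -> nth y (map h (traject f x n)) i = h (iter i f x).
Proof. by move=> i_n; rewrite (nth_map x) ?size_traject // nth_traject. Qed.

Lemma cosz_iter (n : nat) : (n < 785)%N ->
  cosz (Z.of_nat n) = ((iter n rotate (2 ^ 32, 0)).1 / 2 ^ 10)%bZ.
Proof.
move=> n785.
have h : all (fun i => (cosz (Z.of_nat i) =? nth 0%bZ cos_seq i)%bZ)
    (iota 0 785).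
  by vm_cast_no_check (erefl true).
have n_in : n \in iota 0 785 by rewrite mem_iota add0n; exact: n785.
have /Z.eqb_eq -> := allP h n n_in.
exact: nth_map_traject.
Qed.

(** The recurrence is off by at most 784 * 5 < 4 * 2^10 units of 2^-32, that is 4 units of 2^-22;
    dropping ten bits costs one more. *)
Lemma cos_approximation x : `|2 ^+ 22 * cosZ (zr x) - zr (cosz x)| <= 5.
Proof.
have -> : cosz x = cosz (Z.of_nat (zr x : Z785)).
  by rewrite of_nat_val_zr /cosz zp_zp.
move: (zr x) => u; rewrite cosz_iter ?ltn_ord // /cosZ.
have zr10 : zr (2 ^ 10)%bZ = 2 ^+ 10 :> R by exact: (@zrX R 2 10).
have := rotate_error u.
move: (iter _ _ _).1 (zr (iter _ _ _).2 : R) (sinn u) => C S s err.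
have fl : 2 ^+ 10 * zr (C / 2 ^ 10)%bZ <= (zr C : R)
    <= 2 ^+ 10 * zr (C / 2 ^ 10)%bZ + 2 ^+ 10.
  rewrite -zr10 -zrM -zrD; apply/andP; split; apply: zr_le.
    exact: Z.mul_div_le.
  by have := Z.mul_succ_div_gt C (2 ^ 10)%bZ; lia.
have u785 : u%:R * 5 <= 4 * 2 ^+ 10 :> R.
  rewrite -zr10 -zr_nat -[5]/(zr 5) -[4]/(zr 4) -!zrM.
  by apply: zr_le; have := ltn_ord u; lia.
have err1 : `|2 ^+ 32 * cosn u - zr C| <= 4 * 2 ^+ 10.
  rewrite -ler_sqr ?nnegrE ?mulr_ge0 ?exprn_ge0 // real_normK ?num_real //.
  apply: le_trans (_ : (u%:R * 5) ^+ 2 <= _).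
    by apply: le_trans err; rewrite lerDl sqr_ge0.
  by rewrite ler_sqr // nnegrE ?mulr_ge0 ?exprn_ge0.
have K0 : 0 < 2 ^+ 10 :> R by rewrite exprn_gt0.
rewrite -(ler_pM2l K0) -[X in X * `|_|](gtr0_norm K0) -normrM mulrBr mulrA.
rewrite -exprD.
move: err1 fl; rewrite !ler_norml.
move: (2 ^+ (10 + 22)) (2 ^+ 10) (zr C) (zr (C / 2 ^ 10)%bZ) (cosn u).
by move=> a b c d e /andP[h1 h2] /andP[h3 h4]; apply/andP; split; lra.
Qed.

(** * The residues modulo 5 *)

Section CayleyForm.
Variables (R : realFieldType) (n : nat) (S : pred 'I_n.+2).
Hypothesis S_opp : forall x, S (- x) = S x.

Definition cayley : rel 'I_n.+2 := fun v u => S (u - v).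

Lemma cayley_sym : symmetric cayley.
Proof. by move=> u v; rewrite /cayley -opprB S_opp. Qed.

Lemma cayley_shift v a : cayley v (v + a) = S a.
Proof. by rewrite /cayley addrC addKr. Qed.

Lemma cayley_sum v (F : 'I_n.+2 -> R) :
  \sum_u (cayley v u)%:R * F u = \sum_(a | S a) F (v + a).
Proof.
rewrite (reindex_inj (addrI v)) /= [RHS]big_mkcond; apply: eq_bigr => a _.
by rewrite cayley_shift; case: (S a); rewrite ?mul1r ?mul0r.
Qed.

Lemma edge_pairingE f :
  edge_pairing cayley f f = \sum_v \sum_(a | S a) f v (v + a) ^+ 2 :> R.
Proof.
apply: eq_bigr => v _; rewrite -(cayley_sum v (fun u => f v u ^+ 2)).
by apply: eq_bigr => u _; rewrite expr2 mulrA.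
Qed.

Lemma edge_formE f :
  edge_form S f
    = triangle_form cayley f f + 7 * edge_pairing cayley f f :> R.
Proof.
rewrite edge_pairingE; congr (_ + _); apply: eq_bigr => v _.
transitivity (\sum_u (cayley v u)%:R * \sum_w (cayley v w)%:R
    * ((cayley u w)%:R * f v u * f v w)); last first.
  apply: eq_bigr => u _; rewrite mulr_sumr.
  by apply: eq_bigr => w _; ring.
rewrite (cayley_sum v (fun u => \sum_w (cayley v w)%:R
    * ((cayley u w)%:R * f v u * f v w))); apply: eq_bigr => a _.
rewrite (cayley_sum v (fun w => (cayley (v + a) w)%:R * f v (v + a) * f v w)).
rewrite big_mkcondr; apply: eq_bigr => b _.
have -> : cayley (v + a) (v + b) = S (a - b).
  by rewrite cayley_sym /cayley; congr S; ring.
by case: (S (a - b)); rewrite ?mul1r ?mul0r.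
Qed.

End CayleyForm.

Definition cls (v : Z785) : 'I_3.+2 := zr (Z.of_nat v).

Lemma cls_zr x : cls (zr x) = zr x.
Proof.
rewrite /cls of_nat_val_zr /zp !zr_mod; congr _%:R; congr Z.to_nat.
by rewrite Z.mod_mod_divide //; exists 157%bZ.
Qed.

Lemma clsD u v : cls (u + v) = cls u + cls v.
Proof. by rewrite -[u]zr_of_nat_ord -[v]zr_of_nat_ord -zrD !cls_zr zrD. Qed.

Lemma clsN u : cls (- u) = - cls u.
Proof. by rewrite -[u]zr_of_nat_ord -zrN !cls_zr zrN. Qed.

Definition lift5 (r : 'I_3.+2) : Z785 := zr (Z.of_nat r).

Lemma zr_eq_mod5 x y : zr x = zr y :> 'I_3.+2 -> (x mod 5 = y mod 5)%bZ.
Proof.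
move=> /(congr1 val); rewrite !val_zr -[Z.of_nat 5]/5%bZ.
have := Z.mod_pos_bound x 5 ltac:(lia).
have := Z.mod_pos_bound y 5 ltac:(lia).
by lia.
Qed.

Lemma same_cls a b b' : cls b = cls b' -> same a b = same a b'.
Proof.
rewrite -[a]zr_of_nat_ord -[b]zr_of_nat_ord -[b']zr_of_nat_ord !same_zr !cls_zr.
move=> /zr_eq_mod5 h; rewrite /same_side.
by rewrite (Z.mul_mod (Z.of_nat b)) // h -Z.mul_mod.
Qed.

Lemma cls_lift5 r : cls (lift5 r) = r.
Proof. by rewrite /lift5 cls_zr zr_of_nat_ord. Qed.

Lemma mul_cls (k u v : Z785) : zr 5 * k = 0 -> cls u = cls v -> k * u = k * v.
Proof.
move=> k5; rewrite -[u]zr_of_nat_ord -[v]zr_of_nat_ord !cls_zr.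
move: (Z.of_nat u) (Z.of_nat v) => x y /zr_eq_mod5 h.
rewrite (Z.div_mod x 5) // (Z.div_mod y 5) // h !zrD !zrM !mulrDr.
by rewrite !mulrA ![k * zr 5]mulrC k5 !mul0r.
Qed.

Lemma conn_cls a : conn a -> cls a != 0.
Proof.
have h : all (fun x => connz x ==> ~~ (x mod 5 =? 0)%bZ) (zrange 785).
  by vm_cast_no_check (erefl true).
have := all_Z785 h a => /implyP ha /ha; apply: contra => /eqP.
by rewrite -[0]zr0 => /zr_eq_mod5 ->.
Qed.

Lemma zr5_eq i (r : 'I_3.+2) : (zr i == r) = (i mod 5 =? Z.of_nat r)%bZ.
Proof.
apply/eqP/Z.eqb_spec => [<-|h].
  rewrite val_zr Z2Nat.id //; apply: (Z.mod_pos_bound _ _ _).1; lia.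
by rewrite zr_mod -[Z.of_nat 5]/5%bZ h Nat2Z.id natr_Zp.
Qed.

Lemma sum_count (A : pzSemiRingType) (T : Type) (b : pred T) (l : seq T) :
  \sum_(i <- l) (b i)%:R = (count b l)%:R :> A.
Proof. by elim: l => [|i l IH]; rewrite ?big_nil // big_cons IH -natrD. Qed.

Lemma mem_conn_list a : conn a -> Z.of_nat a \in conn_list.
Proof.
have h : all (fun x => connz x ==> has (Z.eqb x) conn_list) (zrange 785).
  by vm_cast_no_check (erefl true).
have /implyP h' := all_Z785 h a.
by rewrite -conn_zr zr_of_nat_ord in h' => /h' /hasP[x xin /Z.eqb_eq ->].
Qed.

Lemma conn_class_degree (d : Z785) (t : 'I_3.+2) : conn d ->
  count (fun i => connz (i - Z.of_nat d)%bZ && (i mod 5 =? Z.of_nat t)%bZ)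
    conn_list = (7 * ((t != 0%R) && (t != cls d)))%N.
Proof.
have h : all (fun d => all (fun t =>
    count (fun i => connz (i - d)%bZ && (i mod 5 =? t)%bZ) conn_list
    == (7 * (~~ (0 =? t)%bZ && ~~ (d mod 5 =? t)%bZ))%N) (zrange 5)) conn_list.
  by vm_cast_no_check (erefl true).
move=> /mem_conn_list/(allP h)/allP/(_ (Z.of_nat t)) h'.
rewrite (eqP (h' _)); last by apply: mem_zrange; have := ltn_ord t; lia.
rewrite -zr5_eq -/(cls d) [t == cls d]eq_sym; congr (7 * (_ && _))%N.
by rewrite eq_sym -[0]zr0 zr5_eq.
Qed.

(** Translating v to 0 turns the count into the finite check of [conn_class_degree]. *)
Lemma class_degree_conn (R : realFieldType) v u t : cayley conn v u ->
  \sum_(w | cls w == t) (cayley conn v w)%:R * (cayley conn u w)%:R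
    = 7 * ((t != cls v) && (t != cls u))%:R :> R.
Proof.
rewrite {1}/cayley; set d := u - v => connd.
have uE : u = v + d by rewrite /d addrC subrK.
transitivity (\sum_w (cayley conn v w)%:R
    * ((cls w == t)%:R * (cayley conn u w)%:R) : R).
  rewrite big_mkcond /=; apply: eq_bigr => w _.
  by case: (cls w == t); rewrite ?mul1r ?mul0r ?mulr0.
rewrite (cayley_sum conn v
  (fun w => (cls w == t)%:R * (cayley conn u w)%:R)) sum_conn_list.
transitivity (\sum_(i <- conn_list) (connz (i - Z.of_nat d)%bZ
    && (i mod 5 =? Z.of_nat (t - cls v)%R)%bZ)%:R : R).
  apply: eq_bigr => i _; rewrite -natrM mulnb; congr (nat_of_bool _)%:R.
  rewrite andbC; congr andb.
    rewrite /cayley uE -conn_zr zrB zr_of_nat_ord; congr conn.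
    by rewrite opprD addrACA subrr add0r.
  by rewrite -zr5_eq clsD cls_zr eq_sym [cls v + _]addrC -subr_eq eq_sym.
rewrite sum_count conn_class_degree // natrM.
congr (_ * (nat_of_bool (_ && _))%:R).
  by rewrite subr_eq0.
by rewrite uE clsD subr_eq addrC.
Qed.

(** Each of the 157 vertices of a class has 39 neighbours in every other class, and 157 * 39 =
    6123. *)
Lemma class_size_conn (R : realFieldType) r t :
  class_sum (cayley conn) cls (fun _ _ => 1) r t = 6123 * (r != t)%:R :> R.
Proof.
have h1 : all (fun t => count (fun i => (i mod 5 =? t)%bZ) (zrange 785)
   == 157%N) (zrange 5) by vm_cast_no_check (erefl true).
have h2 : all (fun t => count (fun i => (i mod 5 =? t)%bZ) conn_list
   == (39 * ~~ (0 =? t)%bZ)%N) (zrange 5) by vm_cast_no_check (erefl true).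
have mem5 (s : 'I_3.+2) : Z.of_nat s \in zrange 5.
  by apply: mem_zrange; have := ltn_ord s; lia.
rewrite /class_sum.
transitivity (\sum_(v | cls v == r) 39 * (r != t)%:R : R).
  apply: eq_bigr => v /eqP vr.
  transitivity (\sum_u (cayley conn v u)%:R * (cls u == t)%:R : R).
    rewrite big_mkcond /=; apply: eq_bigr => u _.
    by case: (cls u == t); rewrite ?mulr1 ?mulr0.
  rewrite (cayley_sum conn v (fun u => (cls u == t)%:R)) sum_conn_list.
  transitivity (\sum_(i <- conn_list)
      (i mod 5 =? Z.of_nat (t - r)%R)%bZ%:R : R).
    apply: eq_bigr => i _; congr (nat_of_bool _)%:R.
    by rewrite -zr5_eq clsD cls_zr vr eq_sym [r + _]addrC -subr_eq eq_sym.
  rewrite sum_count (eqP (allP h2 _ (mem5 _))) natrM.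
  rewrite -[(0 =? _)%bZ]/(0 mod 5 =? _)%bZ -zr5_eq zr0 eq_sym subr_eq0.
  by rewrite [t == r]eq_sym.
rewrite -mulr_suml; congr (_ * _).
rewrite big_const iter_addr_0.
have -> : #|[pred v | cls v == r]| = 157.
  transitivity (count (fun i => (i mod 5 =? Z.of_nat r)%bZ) (zrange 785));
    last exact: (eqP (allP h1 _ (mem5 r))).
  rewrite -sum1_count -sum1_card.
  rewrite [RHS]big_map -[iota 0 785]/(index_iota 0 785) [RHS]big_mkord.
  by apply: eq_bigl => v; rewrite inE /= zr5_eq.
by rewrite -[39 *+ 157]mulr_natr; ring.
Qed.

Section Balanced.
Variables (R : realFieldType) (f : Z785 -> Z785 -> R).
Hypothesis class_f : forall r t, class_sum (cayley conn) cls f r t = 0.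

(* When [5 k = 0] the character depends on the residues mod 5 only. *)
Lemma balanced_mode (T : Z785 -> R) k : zr 5 * k = 0 -> balanced (mode f T k).
Proof.
move=> k5 b; rewrite /mode exchange_big /=.
transitivity (\sum_v \sum_u (cayley conn v u)%:R * f v u
   * ((same b (lift5 (cls u) - lift5 (cls v)))%:R
      * T (k * (lift5 (cls v) + lift5 (cls u))))).
  apply: eq_bigr => v _.
  transitivity (\sum_u (cayley conn v u)%:R
      * ((same b (u - v))%:R * (f v u * T (k * (v + u))))).
    rewrite (cayley_sum conn v
      (fun u => (same b (u - v))%:R * (f v u * T (k * (v + u))))).
    rewrite big_mkcondr; apply: eq_bigr => a _.
    rewrite -[in RHS]addrA [_ + (a - v)]addrCA subrr addr0.
    by case: (same b a); rewrite ?mul1r ?mul0r.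
  apply: eq_bigr => u _.
  rewrite (@same_cls b (u - v) (lift5 (cls u) - lift5 (cls v))); last first.
    by rewrite !clsD !clsN !cls_lift5.
  rewrite (@mul_cls k (v + u) (lift5 (cls v) + lift5 (cls u))) //; last first.
    by rewrite !clsD !cls_lift5.
  by rewrite [RHS]mulrCA -[in RHS]mulrA [LHS]mulrCA.
rewrite (sum_by_class (cayley conn) cls f
   (fun r t => (same b (lift5 t - lift5 r))%:R
      * T (k * (lift5 r + lift5 t)))).
by rewrite big1 // => r _; rewrite big1 // => t _; rewrite class_f mulr0.
Qed.

End Balanced.

Lemma double_inj785 (x : Z785) : x + x = 0 -> x = 0.
Proof.
(* 393 is the inverse of 2 modulo 785. *)
move=> x2; have : zr 393 * zr 2 * x = 0.
  by rewrite -mulrA -[2%bZ]/(Z.of_nat 2) zr_nat mulr_natl mulr2n x2 mulr0.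
have -> : zr 393 * zr 2 = 1 :> Z785.
  by rewrite -zrM; apply: val_inj; rewrite val_zr.
by rewrite mul1r.
Qed.

Lemma spectral_gap (f : Z785 -> Z785 -> R) : (forall u v, f u v = f v u) ->
  (forall r t, class_sum (cayley conn) cls f r t = 0) ->
  16^-1 * edge_pairing (cayley conn) f f
    <= triangle_form (cayley conn) f f + 7 * edge_pairing (cayley conn) f f.
Proof.
move=> f_sym class_f; rewrite -(edge_formE conn_opp) edge_pairingE.
have cN := trig_cN cos_trig_system.
apply: (edge_form_lower_bound cos_trig_system double_inj785 conn_opp f_sym).
  move=> k; apply: (mode_form_lower_bound cN cos_approximation) => [a|k5].
    exact: mode_opp.
  exact: balanced_mode.
move=> k; apply: (mode_form_lower_bound cN cos_approximation) => [a|k5].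
  exact: mode_opp.
exact: balanced_mode.
Qed.

Theorem good_coloring_pullback (x : Z785 -> Z785 -> R) :
  (forall u v, x u v = x v u) -> (forall u v, x u v ^+ 2 = 1) ->
  (forall u v w, cayley conn u v -> cayley conn v w -> cayley conn u w ->
    x u v * x u w + x v u * x v w + x w u * x w v = -1) ->
  exists G, forall u v, cayley conn u v -> x u v = G (cls u) (cls v).
Proof.
move=> x_sym x_sqr x_tri.
apply: (@coloring_pullback R _ _ (cayley conn) cls _ _ _ _ 6123) => //.
- exact: cayley_sym conn_opp.
- move=> u v; rewrite /cayley => /conn_cls; rewrite clsD clsN subr_eq0.
  by rewrite eq_sym.
- by rewrite card_ord.
- exact: class_degree_conn.
- exact: class_size_conn.
- exact: spectral_gap.
Qed.

(** * The Folkman graph *)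

(** A partial assignment is the list of values of the first variables; the size guards keep the
    default of [nth] from closing a branch. *)
Definition violated (a : seq bool) (t : nat * nat * nat) : bool :=
  let: (i, j, k) := t in
  [&& i < size a, j < size a, k < size a,
      nth false a i == nth false a j & nth false a j == nth false a k]%N.

(* [if] rather than [||] and [&&], whose arguments call-by-value reduction
   would always evaluate. *)
Fixpoint nae_refute (n : nat) (T : seq (nat * nat * nat)) (a : seq bool) :=
  if has (violated a) T then true
  else if n is n'.+1 then
    if nae_refute n' T (rcons a true) then nae_refute n' T (rcons a false)
    else false
  else false.

(** One branch of the search follows the values of f, and the triple that closes it is constant
    under f. *)
Lemma nae_refuteP n T (f : nat -> bool) a : nae_refute n T a ->
  a = mkseq f (size a) ->
  exists2 t, t \in T & f t.1.1 = f t.1.2 /\ f t.1.2 = f t.2.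
Proof.
elim: n a => [|n IH] a /=; case: ifP => [/hasP[[[i j] k] tT]|_] //.
- case/and5P=> ia ja ka /eqP ij /eqP jk _ aE; exists (i, j, k) => //=.
  by move: ij jk; rewrite aE !nth_mkseq // => -> ->.
- case/and5P=> ia ja ka /eqP ij /eqP jk _ aE; exists (i, j, k) => //=.
  by move: ij jk; rewrite aE !nth_mkseq // => -> ->.
case: ifP => // ht hf aE.
have next : rcons a (f (size a)) = mkseq f (size (rcons a (f (size a)))).
  by rewrite size_rcons {1}aE -cats1 /mkseq -addn1 iotaD map_cat add0n.
by case E : (f (size a)) next => next; [exact: IH ht next | exact: IH hf next].
Qed.

(* Found by a random search for triangle-free sets of vertices to which no
   pullback of a pentagon coloring extends. *)
Definition apex_nbrs : seq Z :=
  [:: 58; 90; 114; 118; 130; 382; 391; 407; 408; 461; 532; 769; 784]%bZ.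

(** The version of the adjacency that computes; [None] is the additional vertex, the apex. *)
Definition adjz (p q : option Z) : bool :=
  match p, q with
  | Some i, Some j => connz (j - i)%bZ
  | Some i, None | None, Some i => has (Z.eqb (zp i)) apex_nbrs
  | None, None => false
  end.

Definition vtx (p : option Z) : option Z785 := omap zr p.
Definition unvtx (p : option Z785) : option Z :=
  omap (fun u : Z785 => Z.of_nat u) p.

Definition folkman_adj : rel (option Z785) :=
  fun p q => adjz (unvtx p) (unvtx q).

Lemma folkman_adj_some u v : folkman_adj (Some u) (Some v) = cayley conn u v.
Proof. by rewrite /folkman_adj /= -conn_zr zrB !zr_of_nat_ord. Qed.

Lemma folkman_adj_vtx p q : folkman_adj (vtx p) (vtx q) = adjz p q.
Proof.
case: p q => [i|] [j|] //=.
- by rewrite folkman_adj_some /cayley -zrB conn_zr.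
- by rewrite /folkman_adj /= of_nat_val_zr zp_zp.
- by rewrite /folkman_adj /= of_nat_val_zr zp_zp.
Qed.

Lemma folkman_adj_sym : symmetric folkman_adj.
Proof.
move=> [u|] [v|] //; rewrite !folkman_adj_some; exact: cayley_sym conn_opp _ _.
Qed.

Lemma folkman_adj_irrefl : irreflexive folkman_adj.
Proof.
by move=> [u|] //; rewrite folkman_adj_some /cayley subrr -[0]zr0 conn_zr.
Qed.

Definition folkman : sgraph := SGraph folkman_adj_sym folkman_adj_irrefl.

(** * Absence of K4 *)

Lemma no_K4_at_0 a b d : conn a -> conn b -> conn d -> conn (b - a) ->
  conn (d - a) -> conn (d - b) = false.
Proof.
(* [l] holds the common neighbours of 0 and i; they are checked to be pairwise nonadjacent. *)
have h : all (fun i => let l := [seq j <- conn_list | connz (j - i)%bZ] in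
    all (fun j => all (fun k => ~~ connz (k - j)%bZ) l) l) conn_list.
  by vm_cast_no_check (erefl true).
move=> /mem_conn_list/(allP h)/allP h' /mem_conn_list bl /mem_conn_list dl.
rewrite -[a]zr_of_nat_ord -[b]zr_of_nat_ord -[d]zr_of_nat_ord -!zrB !conn_zr.
move=> ba da; apply/negbTE/(allP (h' _ _)); by rewrite mem_filter ?ba ?da.
Qed.

Lemma no_K4 (u v w z : Z785) : cayley conn u v -> cayley conn u w ->
  cayley conn u z -> cayley conn v w -> cayley conn v z ->
  cayley conn w z = false.
Proof.
rewrite /cayley => uv uw uz vw vz.
rewrite -(no_K4_at_0 uv uw uz).
- by congr conn; rewrite opprB addrA subrK.
- by rewrite opprB addrA subrK.
- by rewrite opprB addrA subrK.
Qed.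

Lemma no_apex_K4 (u v w : Z785) : folkman_adj None (Some u) ->
  folkman_adj None (Some v) -> folkman_adj None (Some w) ->
  cayley conn u v -> cayley conn u w -> cayley conn v w = false.
Proof.
have h : all (fun i => all (fun j => all (fun k =>
    ~~ [&& connz (j - i), connz (k - i) & connz (k - j)]%bZ)
    apex_nbrs) apex_nbrs) apex_nbrs by vm_cast_no_check (erefl true).
have mem x : folkman_adj None (Some x) -> Z.of_nat x \in apex_nbrs.
  rewrite -[folkman_adj _ _]/(has (Z.eqb (zp (Z.of_nat x))) apex_nbrs).
  rewrite -of_nat_val_zr zr_of_nat_ord.
  by move=> /hasP[y yn /Z.eqb_eq ->].
move=> /mem/(allP h)/allP hu /mem/hu/allP hv /mem/hv.
rewrite /cayley -!conn_zr !zrB !zr_of_nat_ord => huvw uv uw.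
by apply: contraNF huvw => vw; rewrite uv uw.
Qed.

Lemma folkman_K4_free : Kfree 4 folkman.
Proof.
case=> A A4 cliqueA.
have [a [b [d [e [uniq_s sA]]]]] : exists a b d e : folkman,
    uniq [:: a; b; d; e] /\ {subset [:: a; b; d; e] <= A}.
  have : size (enum A) = 4 by rewrite -cardE.
  have := enum_uniq A.
  have : {subset enum A <= A} by move=> x; rewrite mem_enum.
  case: (enum A) => [|a [|b [|d [|e [|]]]]] // sA us _.
  by exists a, b, d, e.
have adjA x y : x \in [:: a; b; d; e] -> y \in [:: a; b; d; e] -> x != y ->
    folkman_adj x y by move=> /sA xA /sA yA; exact: cliqueA.
move: (uniq_s); rewrite /= !inE !negb_or -!andbA.
case/and5P=> nab nad nae nbd /and3P[nbe nde _].
have [ab ad ae] : [/\ folkman_adj a b, folkman_adj a d & folkman_adj a e].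
  by split; apply: adjA; rewrite ?inE ?eqxx ?orbT.
have [bd be de] : [/\ folkman_adj b d, folkman_adj b e & folkman_adj d e].
  by split; apply: adjA; rewrite ?inE ?eqxx ?orbT.
move: ab ad ae bd be de {uniq_s sA adjA nab nad nae nbd nbe nde}.
have S := folkman_adj_sym.
(* The apex is not adjacent to itself, so at most one of the four vertices is the apex and five
   cases remain. *)
case: a b d e => [u|] [v|] [w|] [z|] //;
  rewrite ?folkman_adj_some => ab ad ae bd be de.
- by move: de; rewrite (no_K4 ab ad ae bd be).
- by move: bd; rewrite (no_apex_K4 _ _ _ ab ad) // S.
- by move: be; rewrite (no_apex_K4 _ _ _ ab ae) // S.
- by move: de; rewrite (no_apex_K4 _ _ _ ad ae) // S.
- by move: de; rewrite (no_apex_K4 _ _ _ bd be).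
Qed.

(** * Colorings without monochromatic triangle *)

Section Arrowing.
Variable c : {set folkman} -> bool.
Hypothesis no_mono : ~ exists A : {set folkman},
  [/\ #|A| = 3, clique A & monochromatic c A].

Let col (p q : folkman) : bool := c [set p; q].

Lemma col_sym p q : col p q = col q p.
Proof. by rewrite /col setUC. Qed.

Lemma no_mono_triangle p q r : folkman_adj p q -> folkman_adj q r ->
  folkman_adj p r -> ~ (col p q = col q r /\ col q r = col p r).
Proof.
move=> pq qr pr [e1 e2]; apply: no_mono; exists [set p; q; r].
have neq x y : folkman_adj x y -> x != y.
  by apply: contraTneq => ->; rewrite folkman_adj_irrefl.
have adjS := folkman_adj_sym.
split.
- by rewrite -setUA cardsU1 cards2 !inE negb_or !neq.
- move=> x y; rewrite !inE -!orbA => /or3P[] /eqP-> /or3P[] /eqP->;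
    rewrite ?eqxx //= => _ //; by rewrite ?pq ?qr ?pr // adjS.
exists (col p q) => E /imsetP[[x y]]; rewrite inE /= => xy ->.
rewrite subUset !sub1set !inE -!orbA => /andP[].
have xx z : folkman_adj z z = false := folkman_adj_irrefl z.
move=> /or3P[] /eqP xE /or3P[] /eqP yE; move: xy; rewrite xE yE ?xx // => _;
  rewrite -/(col _ _); first [done | by rewrite col_sym | by rewrite e1
  | by rewrite col_sym e1 | by rewrite e1 e2 | by rewrite col_sym e1 e2].
Qed.

Lemma col_pullback : exists g : 'I_3.+2 -> 'I_3.+2 -> bool,
  forall u v, cayley conn u v -> col (Some u) (Some v) = g (cls u) (cls v).
Proof.
pose x (u v : Z785) : R := if col (Some u) (Some v) then 1 else -1.
have [||u v w uv vw uw|G xG] := @good_coloring_pullback x.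
- by move=> u v; rewrite /x col_sym.
- by move=> u v; rewrite /x; case: ifP => _; rewrite ?sqrrN expr1n.
- have := @no_mono_triangle (Some u) (Some v) (Some w).
  rewrite !folkman_adj_some uv vw uw => /(_ isT isT isT).
  rewrite /x [col (Some v) (Some u)]col_sym [col (Some w) _]col_sym.
  rewrite [col (Some w) (Some v)]col_sym.
  case: (col (Some u) (Some v)); case: (col (Some v) (Some w));
    case: (col (Some u) (Some w)) => h; try (by case: h);
    ring.
exists (fun r s => G r s == 1) => u v /xG <-.
rewrite /x; case: ifP => _; first by rewrite eqxx.
by apply/esym/negbTE/eqP => h; lra.
Qed.

End Arrowing.

(** * Refutation over 23 Boolean variables *)

Definition pairs5 : seq (nat * nat) :=
  [:: (0, 1); (0, 2); (0, 3); (0, 4); (1, 2); (1, 3); (1, 4); (2, 3); (2, 4);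
      (3, 4)]%N.

(** Variables 0 to 9 are the edges of K5, which determine the coloring of L; variables 10 to 22 are
    the edges at the apex. *)
Definition edge_var (p q : option Z) : nat :=
  match p, q with
  | Some i, Some j =>
      let r := Z.to_nat (i mod 5)%bZ in let s := Z.to_nat (j mod 5)%bZ in
      index (minn r s, maxn r s) pairs5
  | Some i, None | None, Some i => (10 + index (zp i) apex_nbrs)%N
  | None, None => 0
  end.

(* Ten triangles of the Cayley graph, one for each triple of residues modulo 5,
   and the triangles at the apex. *)
Definition triangles : seq (option Z * option Z * option Z) :=
  [seq (Some t.1.1, Some t.1.2, Some t.2) | t <-
    [:: (0, 1, 2); (0, 1, 23); (0, 1, 64); (0, 2, 83); (0, 2, 4); (0, 8, 4);
        (1, 2, 3); (1, 2, 24); (1, 3, 84); (2, 3, 4)]%bZ]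
  ++ [seq (None, Some e.1, Some e.2) | e <-
    [seq e <- [seq (i, j) | i <- apex_nbrs, j <- apex_nbrs]
      | connz (e.2 - e.1)%bZ]].

Definition triangle_vars (t : option Z * option Z * option Z) :
    nat * nat * nat :=
  let: (p, q, r) := t in (edge_var p q, edge_var q r, edge_var p r).

(** The ten triples of residues leave only the pentagon colorings of K5, and the triangles at the
    apex exclude each of these. *)
Lemma triangles_refuted : nae_refute 23 (map triangle_vars triangles) [::].
Proof. by vm_cast_no_check (erefl true). Qed.

Lemma triangles_adj : all (fun t : option Z * option Z * option Z =>
  let: (p, q, r) := t in [&& adjz p q, adjz q r & adjz p r]) triangles.
Proof. by vm_cast_no_check (erefl true). Qed.

Lemma pairs5_index (r s : 'I_3.+2) : (r < s)%N ->
  let v := index (val r, val s) pairs5 in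
  (v < 10)%N /\ nth (0, 0)%N pairs5 v = (val r, val s).
Proof.
move=> rs.
have h : all (fun r => all (fun s => (r < s)%N ==> ((r, s) \in pairs5))
    (iota 0 5)) (iota 0 5) by [].
have mem5 (t : 'I_3.+2) : val t \in iota 0 5 by rewrite mem_iota ltn_ord.
have /implyP/(_ rs) rs_in := allP (allP h _ (mem5 r)) _ (mem5 s).
by split; [rewrite -[10%N]/(size pairs5) index_mem | rewrite nth_index].
Qed.

Lemma folkman_arrows : arrows33 folkman.
Proof.
move=> c; apply: NNPP => no_mono.
have [g colg] := col_pullback no_mono.
pose col (p q : folkman) := c [set p; q].
pose f (v : nat) : bool :=
  if (v < 10)%N then
    g (inZp (nth (0, 0)%N pairs5 v).1) (inZp (nth (0, 0)%N pairs5 v).2)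
  else col None (Some (zr (nth 0%bZ apex_nbrs (v - 10)))).
have apexE i : has (Z.eqb (zp i)) apex_nbrs ->
    col None (Some (zr i)) = f (10 + index (zp i) apex_nbrs)%N.
  move=> /hasP[y yn /Z.eqb_eq yE]; rewrite -yE in yn.
  by rewrite /f ltnNge leq_addr addKn nth_index // zr_zp.
have someE i j : connz (j - i)%bZ ->
    (Z.to_nat (i mod 5) < Z.to_nat (j mod 5))%N ->
    col (Some (zr i)) (Some (zr j)) = f (edge_var (Some i) (Some j)).
  move=> ij; rewrite /edge_var => rs.
  rewrite (minn_idPl (ltnW rs)) (maxn_idPr (ltnW rs)).
  have viE : Z.to_nat (i mod 5) = val (zr i : 'I_3.+2) by rewrite val_zr.
  have vjE : Z.to_nat (j mod 5) = val (zr j : 'I_3.+2) by rewrite val_zr.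
  move: rs; rewrite viE vjE => /pairs5_index /= [v10 vE].
  rewrite /f v10 vE /= !valZpK -!cls_zr; apply: colg.
  by rewrite /cayley -zrB conn_zr.
have colC p q : col p q = col q p by rewrite /col setUC.
have colE p q : adjz p q -> col (vtx p) (vtx q) = f (edge_var p q).
  case: p q => [i|] [j|] // ij; last 2 first.
  - by rewrite colC; exact: apexE.
  - exact: apexE.
  (* [g] is not known to be symmetric on all pairs, so an edge is read from the smaller residue to
     the larger. Equal residues contradict [conn_cls]. *)
  have [rs|sr|rs] := ltngtP (Z.to_nat (i mod 5)) (Z.to_nat (j mod 5)).
  - exact: someE.
  - rewrite colC /edge_var minnC maxnC; apply: someE sr.
    by rewrite -conn_zr zrB -opprB conn_opp -zrB conn_zr.
  have : conn (zr (j - i)%bZ) by rewrite conn_zr.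
  move/conn_cls; rewrite cls_zr zrB subr_eq0 => /eqP[]; apply: val_inj.
  by rewrite !val_zr.
have [t /mapP[[[p q] r] tT ->] /= [e1 e2]] :=
  nae_refuteP (f := f) triangles_refuted erefl.
have /and3P[pq qr pr] := allP triangles_adj _ tT.
apply: (@no_mono_triangle c no_mono (vtx p) (vtx q) (vtx r));
  rewrite ?folkman_adj_vtx //.
by rewrite -!/(col _ _) !colE.
Qed.

Local Close Scope ring_scope.

Theorem theorem3 :
  (exists2 n : nat, is_Fe334 n & n <= 786) /\
  (exists G : sgraph, [/\ #|G| = 786, Kfree 4 G & arrows33 G]).
Proof.
have ex786 : exists G : sgraph, [/\ #|G| = 786, Kfree 4 G & arrows33 G].
  exists folkman; split; [|exact: folkman_K4_free|exact: folkman_arrows].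
  by rewrite card_option card_ord.
split=> //.
(* Descent to the least order: by excluded middle, either a smaller graph exists or n is minimal. *)
have : forall n, (n <= 786)%N ->
    (exists G : sgraph, [/\ #|G| = n, Kfree 4 G & arrows33 G]) ->
    exists2 m : nat, is_Fe334 m & (m <= 786)%N.
  elim/ltn_ind => n IH n786 exn.
  have [[G [Gn KG aG]]|minn] := classic (exists G : sgraph,
    [/\ (#|G| < n)%N, Kfree 4 G & arrows33 G]).
    by apply: (IH _ Gn); [exact: leq_trans (ltnW Gn) n786 | exists G].
  exists n => //; split=> // G KG aG; rewrite leqNgt; apply/negP => Gn.
  by apply: minn; exists G.
by move/(_ 786 (leqnn _) ex786).
Qed.
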